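(* In the setting described in the context, for each $1\le r\le N$ the operators $c_r=Q[r]^{N}_{\ N}$ and $\bar c_r=\bar Q[r]_{N}^{\ N}$ commute with $gl(m|n)$ and act on the irreducible $gl(m|n)$-submodule $V(\Lambda)\subseteq V(\tilde\Lambda)$ as the scalars $$c_s=\prod_{k\in\tilde I,\,k\neq s}(\beta_s-\beta_k)^{-1}\prod_{r\in I}\big(\beta_s-\alpha_r-(-1)^{(r)}\big)\quad (s\in\tilde I),\qquad c_i=0\quad (i\in\bar I_0),$$ $$\bar c_s=\prod_{k\in\tilde I',\,k\neq s}(\bar\beta_s-\bar\beta_k)^{-1}\prod_{r\in I'}\big(\bar\beta_s-\bar\alpha_r-(-1)^{(r)}\big)\quad (s\in\tilde I'),\qquad \bar c_i=0\quad (i\in I_0).$$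
   Context: Work over $\mathbb{C}$; $m,n\ge1$, $N=m+n+1$; parity $(p)=0$ for $1\le p\le m$, $(p)=1$ for $m<p\le N$. $gl(m|n+1)$ has homogeneous basis $E_{pq}$ ($1\le p,q\le N$) of parity $(p)+(q)$ with graded bracket $[E_{pq},E_{rs}]=\delta_{qr}E_{ps}-(-1)^{((p)+(q))((r)+(s))}\delta_{ps}E_{rq}$; $gl(m|n)$ is spanned by the $E_{pq}$ with $p,q\le m+n$. Let $V(\tilde\Lambda)$ be a finite-dimensional irreducible $gl(m|n+1)$-module with highest weight having components $\tilde\Lambda_1,\dots,\tilde\Lambda_N$ (eigenvalues of $E_{11},\dots,E_{NN}$ on the highest weight vector), and let $V(\Lambda)\subseteq V(\tilde\Lambda)$ be an irreducible $gl(m|n)$-submodule with highest weight components $\Lambda_1,\dots,\Lambda_{m+n}$. Characteristic roots: for $1\le i\le m$, $\alpha_i=\Lambda_i+m-n-i$, $\bar\alpha_i=i-1-\Lambda_i$, $\beta_i=\tilde\Lambda_i+m-n-1-i$, $\bar\beta_i=i-1-\tilde\Lambda_i$; for $r=m+\mu$ with $1\le\mu\le n$, $\alpha_r=\mu-\Lambda_r-n$, $\bar\alpha_r=\Lambda_r+m+1-\mu$; for $r=m+\mu$ with $1\le\mu\le n+1$, $\beta_r=\mu-\tilde\Lambda_r-n-1$, $\bar\beta_r=\tilde\Lambda_r+m+1-\mu$. Matrices with operator entries: $\mathcal B^p_{\ q}=(-1)^{(p)}E_{pq}$, $\bar{\mathcal B}_p^{\ q}=-(-1)^{(p)(q)}E_{qp}$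 ($1\le p,q\le N$); powers are defined by $(X^k)^p_{\ q}=\sum_r X^p_{\ r}(X^{k-1})^r_{\ q}$, $X^0$ the identity, and polynomials accordingly. Projections $Q[r]=\prod_{k\ne r,1\le k\le N}\frac{\mathcal B-\beta_k}{\beta_r-\beta_k}$ and $\bar Q[r]=\prod_{k\neq r,1\le k\le N}\frac{\bar{\mathcal B}-\bar\beta_k}{\bar\beta_r-\bar\beta_k}$ (operators on $V(\tilde\Lambda)$). Index sets: $I_0=\{1\le i\le m:\alpha_i=\beta_i\}$, $\bar I_0=\{1\le i\le m:\alpha_i=\beta_i+1\}$, $I_1=\{m+1,\dots,m+n\}$, $I=I_0\cup I_1$, $\tilde I=I\cup\{N\}$, $I'=\bar I_0\cup I_1$, $\tilde I'=I'\cup\{N\}$. Standing genericity assumption: the roots $\beta_1,\dots,\beta_N$ are pairwise distinct, as are $\bar\beta_1,\dots,\bar\beta_N$, $\alpha_1,\dots,\alpha_{m+n}$ and $\bar\alpha_1,\dots,\bar\alpha_{m+n}$. *)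

(* Defs.v *)
From mathcomp Require Import all_boot all_order all_algebra.
From mathcomp Require Import complex Rstruct.
Set Implicit Arguments. Unset Strict Implicit. Unset Printing Implicit Defensive.
Import Order.TTheory GRing.Theory Num.Theory.
Local Open Scope ring_scope.

Definition C : numClosedFieldType := (Rdefinitions.R)[i].

(* Conventions: paper indices are 1-based; an ordinal p : 'I_N (0-based)
   stands for the paper index p.+1.  N = m+n+1 = (m+n).+1. *)

Definition par (m k : nat) : bool := (m < k)%N.
Definition sgnb (b : bool) : C := (-1) ^+ b.

(* characteristic roots, 1-based indices; L, Lt : nat -> C give the
   highest weight components Lambda_k, tilde Lambda_k (k 1-based) *)
Definition alpha (m n : nat) (L : nat -> C) (k : nat) : C :=
  if (k <= m)%N then L k + m%:R - n%:R - k%:R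
  else (k - m)%:R - L k - n%:R.
Definition alphabar (m n : nat) (L : nat -> C) (k : nat) : C :=
  if (k <= m)%N then k%:R - 1 - L k
  else L k + m%:R + 1 - (k - m)%:R.
Definition beta (m n : nat) (Lt : nat -> C) (k : nat) : C :=
  if (k <= m)%N then Lt k + m%:R - n%:R - 1 - k%:R
  else (k - m)%:R - Lt k - n%:R - 1.
Definition betabar (m n : nat) (Lt : nat -> C) (k : nat) : C :=
  if (k <= m)%N then k%:R - 1 - Lt k
  else Lt k + m%:R + 1 - (k - m)%:R.

Definition distinct_on (f : nat -> C) (K : nat) : Prop :=
  forall k l, (1 <= k <= K)%N -> (1 <= l <= K)%N -> f k = f l -> k = l.

Section Setting.
Variables (m n d : nat).
Local Notation N := (m + n).+1.
Local Notation idx := 'I_(m + n).+1.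
Local Notation op := 'M[C]_d.
Local Notation vec := 'cV[C]_d.

(* rho p q is the operator representing E_{p+1,q+1} *)
Variable rho : idx -> idx -> op.
Variable P : op.  (* parity operator of the Z2-grading of V *)

Definition is_super_rep : Prop :=
  forall p q r s : idx,
    let e := (par m p.+1 (+) par m q.+1) && (par m r.+1 (+) par m s.+1) in
    rho p q *m rho r s - sgnb e *: (rho r s *m rho p q)
    = (q == r)%:R *: rho p s - sgnb e *: ((p == s)%:R *: rho r q).

(* P is an involution defining the Z2-grading, and E_pq has parity (p)+(q) *)
Definition is_grading : Prop :=
  P *m P = 1%:M /\
  forall p q : idx, rho p q *m P = sgnb (par m p.+1 (+) par m q.+1) *: (P *m rho p q).

Definition subspace (S : vec -> Prop) : Prop :=
  S 0 /\ (forall u v, S u -> S v -> S (u + v)) /\ (forall (a : C) u, S u -> S (a *: u)).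
Definition graded (S : vec -> Prop) : Prop := forall w, S w -> S (P *m w).
Definition invariant (allowed : idx -> idx -> bool) (S : vec -> Prop) : Prop :=
  forall p q w, allowed p q -> S w -> S (rho p q *m w).

Definition all_idx (p q : idx) : bool := true.
Definition glmn_idx (p q : idx) : bool := (p < m + n)%N && (q < m + n)%N.

Definition irreducible_rep : Prop :=
  forall S, subspace S -> graded S -> invariant all_idx S ->
    (forall w, S w -> w = 0) \/ (forall w, S w).

Definition has_highest_weight (Lt : nat -> C) : Prop :=
  exists v : vec, v != 0 /\
    (forall p : idx, rho p p *m v = Lt p.+1 *: v) /\
    (forall p q : idx, (p < q)%N -> rho p q *m v = 0).

Definition irreducible_glmn_submodule (W : vec -> Prop) : Prop :=
  subspace W /\ graded W /\ invariant glmn_idx W /\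
  forall S, subspace S -> graded S -> invariant glmn_idx S ->
    (forall w, S w -> W w) ->
    (forall w, S w -> w = 0) \/ (forall w, W w -> S w).

Definition glmn_highest_weight (W : vec -> Prop) (L : nat -> C) : Prop :=
  exists w : vec, W w /\ w != 0 /\
    (forall p : idx, (p < m + n)%N -> rho p p *m w = L p.+1 *: w) /\
    (forall p q : idx, (p < q)%N -> (q < m + n)%N -> rho p q *m w = 0).

Definition opB : 'M[op]_((m + n).+1) :=
  \matrix_(p, q) (sgnb (par m p.+1) *: rho p q).
Definition opBbar : 'M[op]_((m + n).+1) :=
  \matrix_(p, q) (- (sgnb (par m p.+1 && par m q.+1) *: rho q p)).
Definition cst (x : C) : 'M[op]_((m + n).+1) := (x%:M)%:M.

Definition Qproj (X : 'M[op]_((m + n).+1)) (b : nat -> C) (r : idx)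
  : 'M[op]_((m + n).+1) :=
  \prod_(k < (m + n).+1 | k != r)
     ((X - cst (b k.+1)) * cst ((b r.+1 - b k.+1)^-1)).

Definition c_op (Lt : nat -> C) (r : idx) : op :=
  Qproj opB (beta m n Lt) r ord_max ord_max.
Definition cbar_op (Lt : nat -> C) (r : idx) : op :=
  Qproj opBbar (betabar m n Lt) r ord_max ord_max.

End Setting.

Section IndexSets.
Variables (m n : nat) (L Lt : nat -> C).
Definition I0 (i : nat) : bool :=
  (1 <= i <= m)%N && (alpha m n L i == beta m n Lt i).
Definition I0bar (i : nat) : bool :=
  (1 <= i <= m)%N && (alpha m n L i == beta m n Lt i + 1).
Definition I1 (r : nat) : bool := (m < r <= m + n)%N.
Definition Iset (r : nat) : bool := I0 r || I1 r.
Definition Itil (r : nat) : bool := Iset r || (r == (m + n).+1).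
Definition Iset' (r : nat) : bool := I0bar r || I1 r.
Definition Itil' (r : nat) : bool := Iset' r || (r == (m + n).+1).

Definition c_val (s : nat) : C :=
  (\prod_(1 <= k < (m + n).+2 | Itil k && (k != s))
      (beta m n Lt s - beta m n Lt k)^-1) *
  \prod_(1 <= r < (m + n).+2 | Iset r)
      (beta m n Lt s - alpha m n L r - sgnb (par m r)).
Definition cbar_val (s : nat) : C :=
  (\prod_(1 <= k < (m + n).+2 | Itil' k && (k != s))
      (betabar m n Lt s - betabar m n Lt k)^-1) *
  \prod_(1 <= r < (m + n).+2 | Iset' r)
      (betabar m n Lt s - alphabar m n L r - sgnb (par m r)).
End IndexSets.

(* Main.v *)
Require Import Defs.
From mathcomp Require Import all_boot all_order all_algebra.
From mathcomp Require Import complex Rstruct ring zify.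
From Stdlib Require Classical.
Set Implicit Arguments. Unset Strict Implicit. Unset Printing Implicit Defensive.
Import Order.TTheory GRing.Theory Num.Theory.
Local Open Scope ring_scope.

(** Write R(x) = (x - B)^-1 and c(x) = R(x)^N_N, so that c_r is the residue of
    c(x) at beta_r.  B is covariant under gl(m|n+1), hence so is R(x), and this
    yields the exchange relation
      (x - y) [R^p_q(x), R^r_s(y)] = R^r_q(x) R^p_s(y) - R^r_q(y) R^p_s(x)
    up to signs.  At y = x + 1 it gives
      c(x) (1 - str (x + 1 - A)^-1) = (1 - str R(x)) c(x + 1),
    where A is the gl(m|n) block of B.  Each of the two supertraces acts on an
    extremal vector by an explicit product, and the second one is central.  So
    c(x) on V(Lambda) solves a first-order difference equation, whose solution
    prod_r (x - zeta_r) / prod_k (x - beta_k) is unique among rational functions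
    equivalent to 1/x at infinity.

    The branching rule tilde Lambda_i - Lambda_i in {0, 1} (i <= m), which makes
    the factors of I_0 and bar I_0 cancel as stated, holds because a maximal
    nonzero monomial in the E_pN applied to the highest weight vector of
    V(Lambda) is singular for gl(m|n+1), and each odd E_iN has square zero.

    The barred matrix is the matrix B of the representation twisted by minus the
    supertranspose, for which highest weight vectors become lowest weight
    vectors; this is why extremal vectors are taken with respect to an involution
    [o] of the indices, either the identity or the reversal. *)

(** * Evaluation of complex polynomials at matrices of operators *)

Section PolyEval.
Variables (d K : nat).
Local Notation op := 'M[C]_d.+1.
Local Notation opmx := 'M[op]_K.+1.

(** A ring morphism whose values commute with every matrix, so that [horner_morph] can evaluate
    polynomials over the complex numbers. *)
Definition cstm : {rmorphism C -> opmx} :=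
  (@scalar_mx op K.+1 \o @scalar_mx C d.+1).

Lemma scalar_opE (a : C) (x : op) : a%:M * x = a *: x.
Proof. by rewrite -mulmxE mul_scalar_mx. Qed.

Lemma mul_op_scalar (a : C) (x : op) : x * a%:M = a *: x.
Proof. by rewrite -mulmxE mul_mx_scalar. Qed.

Lemma cstm_mulE (a : C) (X : opmx) p q : (cstm a * X) p q = a *: X p q.
Proof.
rewrite -mulmxE mxE (bigD1 p) //= big1 ?addr0 => [|i ni].
  by rewrite mxE eqxx mulr1n scalar_opE.
by rewrite mxE eq_sym (negPf ni) mul0r.
Qed.

Lemma mul_cstmE (a : C) (X : opmx) p q : (X * cstm a) p q = a *: X p q.
Proof.
rewrite -mulmxE mxE (bigD1 q) //= big1 ?addr0 => [|i ni].
  by rewrite mxE eqxx mulr1n mul_op_scalar.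
by rewrite mxE (negPf ni) mulr0.
Qed.

Lemma cstm_comm (X : opmx) : commr_rmorph cstm X.
Proof. by move=> a; apply/matrixP => i j; rewrite cstm_mulE mul_cstmE. Qed.

Definition ev (X : opmx) : {rmorphism {poly C} -> opmx} :=
  horner_morph (cstm_comm X).

Lemma evX X : ev X 'X = X. Proof. exact: horner_morphX. Qed.
Lemma evC X a : ev X a%:P = cstm a. Proof. exact: horner_morphC. Qed.

Lemma evZ X a f p q : ev X (a *: f) p q = a *: ev X f p q.
Proof. by rewrite -mul_polyC rmorphM /= evC cstm_mulE. Qed.

Lemma ev_comm X Y f : X * Y = Y * X -> ev X f * Y = Y * ev X f.
Proof.
move=> cXY; elim/poly_ind: f => [|f c IH]; first by rewrite rmorph0 mul0r mulr0.
rewrite rmorphD rmorphM /= evX evC mulrDl mulrDr -mulrA cXY !mulrA IH.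
by rewrite (cstm_comm Y).
Qed.

Lemma ev_XM (X : opmx) j : ev X 'X^(j.+1) = X * ev X 'X^j.
Proof. by rewrite exprS rmorphM /= evX. Qed.

Lemma ev_coef (X : opmx) (f : {poly C}) (n : nat) : (size f <= n)%N -> forall p q,
  ev X f p q = \sum_(j < n) f`_j *: ev X 'X^j p q.
Proof.
move=> sf p q.
have -> : f = \sum_(j < n) f`_j *: 'X^j.
  rewrite -poly_def; apply/polyP => i; rewrite coef_poly.
  by case: ltnP => // le; rewrite nth_default // (leq_trans sf).
rewrite rmorph_sum summxE; apply: eq_bigr => j _ /=.
rewrite evZ coef_sum (bigD1 j) //= coefZ coefXn eqxx mulr1 big1 ?addr0 //.
by move=> i ni; rewrite coefZ coefXn eq_sym (negPf (ni : (i : nat) != j)) mulr0.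
Qed.

(* The powers of X are linearly dependent: they live in a space of dimension
   (K+1)^2 (d+1)^2 over C. *)
Lemma annihilating_poly (X : opmx) : exists2 f : {poly C}, f != 0 & ev X f = 0.
Proof.
pose T := ('I_K.+1 * 'I_K.+1 * ('I_d.+1 * 'I_d.+1))%type.
pose M : 'M[C]_(#|{: T}|.+1, #|{: T}|) :=
  \matrix_(j, t) ev X 'X^j (enum_val t).1.1 (enum_val t).1.2
                           (enum_val t).2.1 (enum_val t).2.2.
have : kermx M != 0.
  rewrite -mxrank_eq0 mxrank_ker -lt0n subn_gt0.
  by rewrite ltnS rank_leq_col.
case/rowV0Pn=> c; move/sub_kermxP => cM c0.
exists (rVpoly c); first by rewrite -(inj_eq (can_inj rVpolyK)) linear0 in c0 *.
apply/matrixP => p q; apply/matrixP => i j.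
rewrite (@ev_coef _ _ #|{: T}|.+1) ?size_poly // !mxE summxE.
move/rowP: cM => /(_ (enum_rank ((p, q), (i, j)))); rewrite !mxE => cM.
rewrite -[RHS]cM; apply: eq_bigr => k _; rewrite !mxE enum_rankK /= coef_rVpoly.
by case: insubP => /= [u _ /val_inj ->|]; rewrite ?ltn_ord.
Qed.

End PolyEval.

(** * Divided differences *)

Section DividedDifference.
Implicit Types (f : {poly C}) (x : C) (n : nat).

(* (f(x) - f) / (x - X) *)
Definition quot_at n f x : {poly C} :=
  \poly_(j < n) (drop_poly j.+1 f).[x].

Lemma drop_poly_MXaddC j (g : {poly C}) c : drop_poly j.+1 (g * 'X + c%:P) = drop_poly j g.
Proof.
by apply/polyP => i; rewrite !coef_drop_poly addnS coefD coefMX coefC /= addr0.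
Qed.

(** Horner's rule: for f = g X + c the quotient at x is g(x) plus X times the quotient of g at x. *)
Lemma quot_atP n f x : (size f <= n)%N ->
  quot_at n f x * (x%:P - 'X) = f.[x]%:P - f.
Proof.
elim/poly_ind: f n => [|g c IH] n sf.
  rewrite horner0 subr0 (_ : quot_at _ _ _ = 0) ?mul0r //.
  by apply/polyP => i; rewrite coef_poly /drop_poly coef0 size_poly0 poly_def big_ord0 horner0 if_same.
have [g0|g0] := eqVneq g 0.
  rewrite g0 mul0r add0r hornerC subrr (_ : quot_at _ _ _ = 0) ?mul0r //.
  apply/polyP => i; rewrite coef_poly coef0.
  have := drop_poly_MXaddC i 0 c; rewrite mul0r add0r => ->.
  by rewrite linear0 horner0 if_same.
have sg : (size g < n)%N by move: sf; rewrite size_MXaddC (negPf g0).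
case: n sg sf => // n sg _.
have -> : quot_at n.+1 (g * 'X + c%:P) x = g.[x]%:P + 'X * quot_at n g x.
  apply/polyP => i; rewrite coefD coefC coefXM !coef_poly drop_poly_MXaddC.
  case: i => [|i] /=; first by rewrite drop_poly0l addr0.
  by rewrite ltnS add0r.
rewrite mulrDl -mulrA IH; last by rewrite ltnS in sg.
rewrite !hornerE /= polyCD polyCM; ring.
Qed.

End DividedDifference.

(** Entries are linear forms that separate matrices; keeping [h] abstract lets a tactic push it to
    the atoms and finish by [ring] over the scalars. *)
Lemma mx_forms k l (x y : 'M[C]_(k, l)) :
  (forall h : 'M[C]_(k, l) -> C, {morph h : u v / u + v} -> {morph h : u / - u} ->
     (forall a u, h (a *: u) = a * h u) -> h 0 = 0 -> h x = h y) -> x = y.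
Proof.
move=> h; apply/matrixP => i j; apply: (h (fun z => z i j)).
- by move=> u v; rewrite mxE.
- by move=> u; rewrite mxE.
- by move=> a u; rewrite mxE.
- by rewrite mxE.
Qed.

(** Returns a proof that [h t] equals the scalar expression obtained by moving [h] down to the atoms
    of [t]. *)
Ltac lin_form h hD hN hZ h0 t :=
  match t with
  | (?a + ?b)%R =>
      let pa := lin_form h hD hN hZ h0 a in let pb := lin_form h hD hN hZ h0 b in
      constr:(etrans (hD a b) (f_equal2 (fun u v : C => u + v) pa pb))
  | (- ?a)%R =>
      let pa := lin_form h hD hN hZ h0 a in
      constr:(etrans (hN a) (f_equal (fun u : C => - u) pa))
  | (?c *: ?a)%R =>
      let pa := lin_form h hD hN hZ h0 a in
      constr:(etrans (hZ c a) (f_equal (fun u : C => c * u) pa))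
  | 0%R => constr:(h0)
  | _ => constr:(erefl (h t))
  end.

(* Proves a linear identity between operators by testing it on linear forms,
   after splitting on the parities of the indices. *)
Ltac mx_ring :=
  let h := fresh "h" in let hD := fresh "hD" in let hN := fresh "hN" in
  let hZ := fresh "hZ" in let h0 := fresh "h0" in
  apply: mx_forms => h hD hN hZ h0;
  match goal with |- h ?x = h ?y =>
    let px := lin_form h hD hN hZ h0 x in
    let py := lin_form h hD hN hZ h0 y in
    refine (etrans px (etrans _ (esym py))) end;
  clear hD hN hZ h0;
  repeat match goal with |- context [h ?x] => move: (h x) => ? end; clear h;
  rewrite /sgnb;
  repeat match goal with |- context [par ?m ?k] => case: (par m k) end;
  rewrite /= ?expr0 ?expr1; ring.

(** * Covariance of B and of its polynomials under gl(m|n+1) *)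

Section Covariance.
Variables (m n d : nat).
Local Notation idx := 'I_(m + n).+1.
Local Notation op := 'M[C]_d.+1.
Local Notation opmx := 'M[op]_((m + n).+1).
Variable rho : idx -> idx -> op.
Hypothesis rhoP : is_super_rep rho.
Local Notation e p := (par m p.+1).
Local Notation sg := sgnb.

(** Zero padding outside J gives the block A the same size as B, so that one set of lemmas covers
    both. *)
Definition trunc (J : pred idx) : opmx :=
  \matrix_(p, q) (if J p && J q then sg (e p) *: rho p q else 0).

(* The action of E_ab on C^{m|n+1} tensored with the module, up to Koszul signs;
   [covP]: covariance under E_ab is commutation with this matrix. *)
Definition adj_mx (a b : idx) : opmx :=
  \matrix_(p, q) ((p == q)%:R *: (sg ((e a (+) e b) && e p) *: rho a b)
    - ((p == b) && (q == a))%:R *: (sg ((e a (+) e b) && e a))%:M).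

(** The graded bracket with E_ab, arranged so that each side is an entry of a product with
    [adj_mx]. *)
Definition cov_at (a b : idx) (M : opmx) := forall p q : idx,
  sg ((e a (+) e b) && e p) *: (rho a b * M p q)
    - (p == b)%:R *: (sg ((e a (+) e b) && e a) *: M a q)
  = sg ((e a (+) e b) && e q) *: (M p q * rho a b)
    - (q == a)%:R *: (sg ((e a (+) e b) && e a) *: M p b).

Lemma adj_mxE a b M p q : (adj_mx a b * M) p q =
  sg ((e a (+) e b) && e p) *: (rho a b * M p q)
    - (p == b)%:R *: (sg ((e a (+) e b) && e a) *: M a q).
Proof.
rewrite -mulmxE mxE.
under eq_bigr do rewrite mxE mulrBl -!scalerAl scalar_opE.
rewrite sumrB; congr (_ - _).
  rewrite (bigD1 p) //= eqxx scale1r big1 ?addr0 // => i ni.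
  by rewrite eq_sym (negPf ni) scale0r.
rewrite (bigD1 a) //= eqxx andbT big1 ?addr0 // => i ni.
by rewrite (negPf ni) andbF scale0r.
Qed.

Lemma mul_adj_mxE a b M p q : (M * adj_mx a b) p q =
  sg ((e a (+) e b) && e q) *: (M p q * rho a b)
    - (q == a)%:R *: (sg ((e a (+) e b) && e a) *: M p b).
Proof.
rewrite -mulmxE mxE.
under eq_bigr do rewrite mxE mulrBr -!scalerAr mul_op_scalar.
rewrite sumrB; congr (_ - _).
  rewrite (bigD1 q) //= eqxx scale1r big1 ?addr0 // => i ni.
  by rewrite (negPf ni) scale0r.
rewrite (bigD1 b) //= eqxx big1 ?addr0 // => i ni.
by rewrite (negPf ni) scale0r.
Qed.

Lemma covP a b M : cov_at a b M <-> M * adj_mx a b = adj_mx a b * M.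
Proof.
split=> [h | h p q]; last by rewrite -adj_mxE -mul_adj_mxE h.
by apply/matrixP => p q; rewrite adj_mxE mul_adj_mxE h.
Qed.

Lemma rho_comm p q r s : rho p q * rho r s =
  sg ((e p (+) e q) && (e r (+) e s)) *: (rho r s * rho p q)
  + ((q == r)%:R *: rho p s
     - sg ((e p (+) e q) && (e r (+) e s)) *: ((p == s)%:R *: rho r q)).
Proof. by have := rhoP p q r s; rewrite /= !mulmxE => <-; rewrite addrC subrK. Qed.

(** Inside J this is the defining bracket. If p or q lies outside J every term vanishes, since a and
    b lie in J and the padding is zero. *)
Lemma cov_trunc (J : pred idx) a b : J a -> J b -> cov_at a b (trunc J).
Proof.
move=> Ja Jb p q; rewrite !mxE Ja Jb /= andbT.
have [Jp|nJp] := boolP (J p); last first.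
  have /negPf-> : p != b by apply: contraNneq nJp => ->.
  by rewrite /= mulr0 mul0r !scaler0 scale0r subrr.
have [Jq|nJq] := boolP (J q); last first.
  have /negPf-> : q != a by apply: contraNneq nJq => ->.
  by rewrite /= mulr0 mul0r !scaler0 scale0r subrr.
rewrite /= -scalerAr rho_comm -scalerAl.
have -> : (b == p) = (p == b) by rewrite eq_sym.
have -> : (a == q) = (q == a) by rewrite eq_sym.
move: (rho p q * rho a b) => z; rewrite /sgnb.
have [->|_] := eqVneq p b; have [->|_] := eqVneq q a; mx_ring.
Qed.



(** By [covP] covariance is a commutation, hence it passes to polynomials in the matrix, among them
    the resolvents. *)
Lemma cov_ev (J : pred idx) f a b : J a -> J b -> cov_at a b (ev (trunc J) f).
Proof. by move=> Ja Jb; apply/covP/ev_comm/covP/cov_trunc. Qed.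

End Covariance.

(** Reduces [X = Y] to a linear identity for [mx_ring], once the multiple c of the known equation
    that produces it is supplied. *)
Lemma lin_conseq k l (c : C) (L R X Y : 'M[C]_(k, l)) :
  L = R -> X - Y = c *: (L - R) -> X = Y.
Proof. by move=> -> /eqP; rewrite subrr scaler0 subr_eq0 => /eqP. Qed.

(** The bracket with D is a derivation killing c; this is its value on the inverse of c - B. *)
Lemma inverse_bracket (A : pzRingType) (c B R D : A) : c * D = D * c ->
  R * (c - B) = 1 -> (c - B) * R = 1 -> D * R - R * D = R * ((D * B - B * D) * R).
Proof.
move=> cD RB BR.
have -> : D * B - B * D = (c - B) * D - D * (c - B).
  by rewrite mulrBl mulrBr cD opprB [RHS]addrC addrA subrK.
have -> u v : R * ((u - v) * R) = R * u * R - R * v * R.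
  by rewrite mulrBl mulrBr !mulrA.
by rewrite !mulrA RB mul1r -!mulrA BR mulr1.
Qed.

(** The first resolvent identity at two points at distance 1, where no scalar factor appears. *)
Lemma inverse_shift (A : pzRingType) (c B R R1 : A) :
  R * (c - B) = 1 -> (c - B) * R = 1 -> R1 * (c + 1 - B) = 1 ->
  (c + 1 - B) * R1 = 1 -> (R * R1 = R - R1) * (R1 * R = R - R1).
Proof.
rewrite addrAC => RB BR R1B BR1; split.
  have : R * ((c - B + 1) * R1) = R by rewrite BR1 mulr1.
  by rewrite mulrA mulrDr RB mulr1 mulrDl mul1r => h; rewrite -[X in X - _]h addrC addKr.
have : (R1 * (c - B + 1)) * R = R by rewrite R1B mul1r.
by rewrite -mulrA mulrDl BR mul1r mulrDr mulr1 => h; rewrite -[X in X - _]h addrC addKr.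
Qed.

(** * Exchange relations between resolvent entries *)

Section Resolvents.
Variables (m n d : nat).
Local Notation idx := 'I_(m + n).+1.
Local Notation op := 'M[C]_d.+1.
Local Notation opmx := 'M[op]_((m + n).+1).
Variable rho : idx -> idx -> op.
Hypothesis rhoP : is_super_rep rho.
Local Notation e p := (par m p.+1).
Local Notation sg := sgnb.
Local Notation N := (@ord_max (m + n)).
Local Notation cst := (cstm d (m + n)).

Definition full_index : pred idx := predT.
Definition sub_index : pred idx := fun p => (p < m + n)%N.

Definition resolvent J x (R : opmx) :=
  R * (cst x - trunc rho J) = 1 /\ (cst x - trunc rho J) * R = 1.

(* z on the diagonal, with the Koszul signs of an operator of parity (p) + (q) *)
Definition sdiag (p q : idx) (z : op) : opmx :=
  \matrix_(r, s) ((r == s)%:R *: (sg ((e p (+) e q) && e r) *: z)).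

Lemma mulmx_entry (X Y : opmx) p q : (X * Y) p q = \sum_k X p k * Y k q.
Proof. by rewrite -mulmxE mxE. Qed.

Lemma sdiag_mulE p q z (X : opmx) r s :
  (sdiag p q z * X) r s = sg ((e p (+) e q) && e r) *: (z * X r s).
Proof.
rewrite mulmx_entry (bigD1 r) //= big1 ?addr0 => [|i ni].
  by rewrite mxE eqxx scale1r scalerAl.
by rewrite mxE eq_sym (negPf ni) scale0r mul0r.
Qed.

Lemma mul_sdiagE p q z (X : opmx) r s :
  (X * sdiag p q z) r s = sg ((e p (+) e q) && e s) *: (X r s * z).
Proof.
rewrite mulmx_entry (bigD1 s) //= big1 ?addr0 => [|i ni].
  by rewrite mxE eqxx scale1r scalerAr.
by rewrite mxE (negPf ni) scale0r mulr0.
Qed.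

Lemma opmx_subE (X Y : opmx) p q : (X - Y) p q = X p q - Y p q.
Proof. by rewrite !mxE. Qed.

Lemma trunc_allE a b : trunc rho full_index a b = sg (e a) *: rho a b.
Proof. by rewrite mxE. Qed.

Lemma shift_mulE a (X Y : opmx) p q :
  ((cst a - X) * Y) p q = a *: Y p q - \sum_k X p k * Y k q.
Proof. by rewrite mulrBl opmx_subE cstm_mulE mulmx_entry. Qed.

Lemma sgK (b : bool) (z : op) : sg b *: (sg b *: z) = z.
Proof. by rewrite scalerA -expr2 sqrr_sign scale1r. Qed.

(** Covariance read backwards: instead of E_ab acting on the entries of M, the fixed entry M^p_q is
    bracketed with the entry (a, b) of B, up to Koszul signs. *)
Lemma sdiag_bracket (M : opmx) (p q a b : idx) : cov_at rho a b M ->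
  (sdiag p q (M p q) * trunc rho full_index - trunc rho full_index * sdiag p q (M p q)) a b
  = sg (e p && e q) *: ((a == q)%:R *: M p b - (b == p)%:R *: M a q).
Proof.
move=> /(_ p q) covM; rewrite opmx_subE sdiag_mulE mul_sdiagE trunc_allE.
rewrite -scalerAr -scalerAl ![_ == p]eq_sym [a == q]eq_sym.
move: covM; move: (rho a b * M p q) (M p q * rho a b) => z t covM.
have {covM} -> : z = sg ((e a (+) e b) && e p) *:
   (sg ((e a (+) e b) && e q) *: t
    - (q == a)%:R *: (sg ((e a (+) e b) && e a) *: M p b)
    + (p == b)%:R *: (sg ((e a (+) e b) && e a) *: M a q)).
  by rewrite -covM subrK sgK.
by have [->|_] := eqVneq p b; have [->|_] := eqVneq q a; mx_ring.
Qed.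

(** The bracket of M^p_q with B lives in row q and column p only, so sandwiching it between two
    copies of R leaves two products of entries. *)
Lemma resolvent_exchange (M R : opmx) y (p q : idx) :
  (forall a b, cov_at rho a b M) -> resolvent full_index y R -> forall r s : idx,
  sg ((e p (+) e q) && e r) *: (M p q * R r s)
    - sg ((e p (+) e q) && e s) *: (R r s * M p q)
  = sg (e p && e q) *: (R r q * (M * R) p s - (R * M) r q * R p s).
Proof.
move=> covM [RB BR] r s.
set D := sdiag p q (M p q); set B := trunc rho full_index in RB BR.
have DR : D * R - R * D = R * ((D * B - B * D) * R) :=
  inverse_bracket (esym (cstm_comm D y)) RB BR.
have UR a : ((D * B - B * D) * R) a s =
    sg (e p && e q) *: ((a == q)%:R *: (M * R) p s - M a q * R p s).
  rewrite mulmx_entry.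
  under eq_bigr => b _.
    rewrite sdiag_bracket // -scalerAl mulrBl -scalerAl.
    over.
  rewrite -scaler_sumr sumrB -scaler_sumr -mulmx_entry; congr (_ *: (_ - _)).
  rewrite (bigD1 p) //= eqxx scale1r big1 ?addr0 // => i ni.
  by rewrite (negPf ni) scale0r mul0r.
rewrite -sdiag_mulE -mul_sdiagE -opmx_subE DR [LHS]mulmx_entry.
under eq_bigr => a _ do rewrite UR -scalerAr mulrBr -scalerAr.
rewrite -scaler_sumr sumrB; congr (_ *: (_ - _)).
  rewrite (bigD1 q) //= eqxx scale1r big1 ?addr0 // => i ni.
  by rewrite (negPf ni) scale0r.
by rewrite mulmx_entry mulr_suml; apply: eq_bigr => i _; rewrite mulrA.
Qed.

Lemma par_max : par m N.+1.
Proof. by rewrite /par /= ltnS leq_addr. Qed.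

(** * The exchange relation at y = x + 1 *)

Section Shift.
Variables (x : C) (R R1 G : opmx).
Hypotheses (hR : resolvent full_index x R) (hR1 : resolvent full_index (x + 1) R1).
Hypothesis hG : resolvent sub_index (x + 1) G.
Hypothesis covR : forall a b, cov_at rho a b R.

Lemma resolvent_mul : (R * R1 = R - R1) * (R1 * R = R - R1).
Proof.
have [RB BR] := hR; have [] := hR1; rewrite rmorphD rmorph1.
exact: inverse_shift.
Qed.

Lemma corner_exchange q : R1 N N * R N q = R1 N q * R N N.
Proof.
have := resolvent_exchange N q covR hR1 N N.
rewrite !resolvent_mul !opmx_subE par_max /= !mulrBl !mulrBr !andbT => h.
refine (@lin_conseq _ _ (sg (e q)) _ _ _ _ h _). mx_ring.
Qed.

Lemma diagonal_exchange (p : idx) :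
  sg (e p) *: (R p p * R1 N N) =
  sg (e p) *: (R1 p p * R N N - R1 p N * R N p) - R N p * R1 p N.
Proof.
have := resolvent_exchange N p covR hR1 p N.
rewrite !resolvent_mul !opmx_subE par_max /= !mulrBl !mulrBr !andbT => h.
refine (@lin_conseq _ _ 1 _ _ _ _ h _). mx_ring.
Qed.

(** The matrix [Y] of two-by-two minors satisfies (x + 1 - A) Y = c(x) on the gl(m|n) block: its row
    N would vanish by [corner_exchange], so A may be replaced by B, and B R1 = (x + 1) R1 - 1.
    Multiplying by G isolates the entry. *)
Lemma corner_block (p : idx) : sub_index p ->
  R1 p p * R N N - R1 p N * R N p = G p p * R N N.
Proof.
move=> Jp; pose Y : opmx := \matrix_(p, q) (if sub_index p && sub_index q then
  R1 p q * R N N - R1 p N * R N q else 0).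
have [GA AG] := hG; have [RB BR] := hR1.
have eY : (cst (x + 1) - trunc rho sub_index) * Y =
    \matrix_(p, q) (if sub_index p && sub_index q then (p == q)%:R *: R N N else 0).
  apply/matrixP => r q; rewrite shift_mulE [RHS]mxE.
  under eq_bigr do rewrite 2!mxE.
  rewrite mxE.
  case: (boolP (sub_index r)) => /= [Jr|_]; last first.
    by rewrite scaler0 big1 ?subrr // => i _; rewrite mul0r.
  case: (boolP (sub_index q)) => /= [Jq|_]; last first.
    by rewrite scaler0 big1 ?subrr // => i _; rewrite andbF mulr0.
  have -> : \sum_i (if sub_index i then sg (e r) *: rho r i else 0) *
      (if sub_index i && true then R1 i q * R N N - R1 i N * R N q else 0) =
      \sum_i trunc rho full_index r i * (R1 i q * R N N - R1 i N * R N q).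
    apply: eq_bigr => i _; rewrite trunc_allE andbT.
    case: (boolP (sub_index i)) => //= nJi.
    have -> : i = N.
      by apply/val_inj/eqP; rewrite eqn_leq -ltnS ltn_ord /= leqNgt.
    by rewrite corner_exchange subrr !mulr0.
  under eq_bigr do rewrite mulrBr !mulrA.
  rewrite sumrB -!mulr_suml -!mulmx_entry.
  have -> : trunc rho full_index * R1 = cst (x + 1) * R1 - 1.
    by rewrite -[in RHS]BR mulrBl opprB addrC subrK.
  rewrite !opmx_subE !cstm_mulE !mxE.
  have /negPf-> : r != N by apply: contraTneq Jr => ->; rewrite /sub_index /= ltnn.
  rewrite subr0 -[(_ == _)%:R]/((r == q)%:R) mulrBl scalerBr -!scalerAl.
  rewrite mulr_natl scaler_nat.
  move: (R1 r q * R N N) (R1 r N * R N q) (R N N *+ (r == q)) => u v w.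
  by mx_ring.
have := congr1 (fun Z => G * Z) eY; rewrite mulrA GA mul1r.
move=> /matrixP/(_ p p); rewrite mxE Jp /= => ->.
rewrite mulmx_entry (bigD1 p) //= mxE Jp eqxx scale1r big1 ?addr0 // => i ni.
by rewrite mxE Jp (negPf ni) scale0r if_same mulr0.
Qed.

Lemma corner_supertrace :
  (1 - \sum_(p : idx | sub_index p) sg (e p) *: G p p) * R N N =
  (1 - \sum_(p : idx) sg (e p) *: R p p) * R1 N N.
Proof.
rewrite !mulrBl !mul1r !mulr_suml.
under eq_bigr => p Jp do rewrite -scalerAl -corner_block //.
under [in RHS]eq_bigr => p _ do rewrite -scalerAl diagonal_exchange.
(* The sum of the R^N_p R1^p_N is the corner of R R1 = R - R1, which supplies the term 1 on both
   sides. *)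
rewrite sumrB -mulmx_entry !resolvent_mul opmx_subE.
rewrite [in RHS](bigID sub_index) /= [X in _ - (_ + X - _)]big1 ?addr0.
  by rewrite opprB addrA [R1 N N + _]addrC subrK.
move=> p nJp.
have -> : p = N.
  by apply/val_inj/eqP; rewrite eqn_leq -ltnS ltn_ord /= leqNgt.
by rewrite corner_exchange subrr scaler0.
Qed.

End Shift.
End Resolvents.

(** * Resolvents acting on extremal vectors *)

Section Extremal.
Variables (m n d : nat).
Local Notation idx := 'I_(m + n).+1.
Local Notation op := 'M[C]_d.+1.
Local Notation vec := 'cV[C]_d.+1.
Local Notation opmx := 'M[op]_((m + n).+1).
Variable rho : idx -> idx -> op.
Hypothesis rhoP : is_super_rep rho.
Local Notation e p := (par m p.+1).
Local Notation sg := sgnb.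
Local Notation cst := (cstm d (m + n)).

Lemma op_mulE (A B : op) (v : vec) : (A * B) *m v = A *m (B *m v).
Proof. by rewrite -mulmxE mulmxA. Qed.

Lemma ev_shift (X : opmx) x : ev X (x%:P - 'X) = cst x - X.
Proof. by rewrite rmorphB /= evC evX. Qed.

Lemma ev_shift_X (X : opmx) x : ev X ('X - x%:P) = X - cst x.
Proof. by rewrite rmorphB /= evC evX. Qed.

(** As f kills the matrix, the divided difference of f at x, divided by f(x), inverts x minus the
    matrix. Resolvents are thus polynomials in the matrix. *)
Lemma ev_resolvent (J : pred idx) (f : {poly C}) k x :
  ev (trunc rho J) f = 0 -> f.[x] != 0 -> (size f <= k)%N ->
  resolvent rho J x (ev (trunc rho J) (f.[x]^-1 *: quot_at k f x)).
Proof.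
move=> f0 fx sf; set X := trunc rho J.
have E : (f.[x]^-1 *: quot_at k f x) * (x%:P - 'X) = 1 - f.[x]^-1 *: f.
  rewrite -scalerAl quot_atP // scalerBr; congr (_ - _).
  by rewrite -mul_polyC -polyCM mulVf.
have E1 : ev X (1 - f.[x]^-1 *: f) = 1.
  by rewrite rmorphB rmorph1 -mul_polyC rmorphM /= [ev X f]f0 mulr0 subr0.
by split; rewrite -ev_shift -rmorphM /= ?[(_ - _) * _]mulrC E E1.
Qed.

Section Vector.
Variables (J : pred idx) (o : idx -> idx) (v : vec) (lam : idx -> C).
Hypothesis oK : involutive o.
Hypothesis vdiag : forall p, J p -> rho p p *m v = lam p *: v.
Hypothesis vup : forall p q, J p -> J q -> (o p < o q)%N -> rho p q *m v = 0.
Local Notation X := (trunc rho J).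

Lemma cov_vec (a b p q : idx) (M : opmx) : cov_at rho a b M ->
  sg ((e a (+) e b) && e p) *: (rho a b *m (M p q *m v))
    - (p == b)%:R *: (sg ((e a (+) e b) && e a) *: (M a q *m v))
  = sg ((e a (+) e b) && e q) *: (M p q *m (rho a b *m v))
    - (q == a)%:R *: (sg ((e a (+) e b) && e a) *: (M p b *m v)).
Proof.
move=> /(_ p q) cov.
have E (x y z : C) (A B : op) :
    ((x *: A) - y *: (z *: B)) *m v = x *: (A *m v) - y *: (z *: (B *m v)).
  by rewrite mulmxBl -!scalemxAl.
by rewrite -!op_mulE -[LHS]E -[RHS]E cov.
Qed.

Lemma raise_entry (p q r : idx) (M : opmx) : cov_at rho p r M ->
  rho p r *m v = 0 -> p != q -> M p q *m v = 0 ->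
  rho p r *m (M r q *m v) = 0.
Proof.
move=> cov rv npq Mv; have := cov_vec r q cov.
rewrite eqxx scale1r [q == p]eq_sym (negPf npq) scale0r subr0.
rewrite Mv rv mulmx0 !scaler0 subr0.
by move=> /eqP; rewrite scaler_eq0 signr_eq0 => /eqP.
Qed.

(** Induction on the power: in the sum of the X^p_r (X^j)^r_q v, the terms with r before q vanish by
    induction; in the others E_pr kills v, and moving it through by covariance only produces
    (X^j)^p_q v = 0. *)
Lemma ev_upper f (p q : idx) : (o p < o q)%N -> ev X f p q *m v = 0.
Proof.
have powers j (p' q' : idx) : (o p' < o q')%N -> ev X 'X^j p' q' *m v = 0.
  elim: j p' q' => [|j IH] {}p {}q lpq.
    rewrite expr0 rmorph1 mxE (_ : (p == q) = false) ?mul0mx //. 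
    by apply: contraTF lpq => /eqP->; rewrite ltnn.
  rewrite ev_XM mulmx_entry mulmx_suml big1 // => r _; rewrite op_mulE.
  have [lrq|lqr] := ltnP (o r) (o q); first by rewrite IH // mulmx0.
  rewrite mxE; case: ifP => [/andP[Jp Jr]|_]; last by rewrite mul0mx.
  rewrite -scalemxAl -[RHS](scaler0 _ (sg (e p))); congr (_ *: _).
  apply: raise_entry; first exact: cov_ev.
  - by apply: vup => //; apply: leq_trans lpq lqr.
  - by apply: contraTneq lpq => ->; rewrite ltnn.
  - exact: IH.
move=> lpq; rewrite (ev_coef X (leqnn (size f))) mulmx_suml big1 // => j _.
by rewrite -scalemxAl powers ?scaler0.
Qed.

(** The characteristic root at p for the order given by [o]; it specializes to the four families of
    roots in [root_beta], [root_alpha], [root_betabar] and [root_alphabar]. *)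
Definition root_at (p : idx) : C :=
  sg (e p) * lam p + \sum_(q : idx | J q && (o p < o q)%N) sg (e q).

Lemma lower_entry (M : opmx) (p q : idx) : cov_at rho p q M ->
  rho p q *m v = 0 ->
  sg (e p) *: (rho p q *m (M q p *m v)) = sg (e q) *: (M p p *m v - M q q *m v).
Proof.
move=> cov rv; have := cov_vec q p cov.
rewrite !eqxx !scale1r rv mulmx0 scaler0 sub0r => h.
refine (@lin_conseq _ _ (sg (e p (+) e q) * sg (e p && e q)) _ _ _ _ h _).
mx_ring.
Qed.

(** The diagonal entry at p of (x - X) R = 1, applied to v. The terms with k before p vanish by
    [ev_upper]; those with k after p become, up to sign, R^p_p v - R^k_k v by [lower_entry]. *)
Lemma resolvent_diag x f (p : idx) : J p -> resolvent rho J x (ev X f) ->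
  (x - root_at p) *: (ev X f p p *m v) =
  v - \sum_(q : idx | J q && (o p < o q)%N) sg (e q) *: (ev X f q q *m v).
Proof.
set R := ev X f => Jp [_ /matrixP/(_ p p)].
rewrite shift_mulE mxE eqxx => /(congr1 (fun z => z *m v)).
rewrite mulmxBl -scalemxAl mul1mx mulmx_suml.
set S := (X in v - X).
have -> : \sum_k (X p k * R k p) *m v = root_at p *: (R p p *m v) - S.
  rewrite /root_at scalerDl scaler_suml -addrA -sumrB (bigD1 p) //=.
  congr (_ + _).
    rewrite op_mulE mxE Jp -scalemxAl -scalerA; congr (_ *: _).
    have := cov_vec p p (cov_ev rhoP f Jp Jp).
    rewrite vdiag // -/R addbb /sgnb expr0 !scale1r -scalemxAr => /addIr.
    by [].
  rewrite big_mkcond [RHS]big_mkcond; apply: eq_bigr => k _.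
  have [->|nkp] := eqVneq k p; first by rewrite ltnn andbF.
  rewrite op_mulE mxE Jp /=; case: (boolP (J k)) => [Jk|_]; last by rewrite mul0mx.
  rewrite -scalemxAl /=; case: ltngtP => [lpk|lkp|epk].
  - transitivity (sg (e k) *: (R p p *m v - R k k *m v)); last exact: scalerBr.
    by apply: lower_entry; [exact: cov_ev | exact: vup].
  - by rewrite ev_upper // mulmx0 scaler0.
  by move: nkp; rewrite -(inj_eq (inv_inj oK)) -val_eqE /= epk eqxx.
move=> h; refine (@lin_conseq _ _ 1 _ _ _ _ h _).
by move: (R p p *m v) => u; mx_ring.
Qed.

(** By [resolvent_diag], (x - root_p) R^p_p v is v minus the supertrace over the positions after p.
    Including p therefore multiplies this vector by 1 - (-1)^(p) / (x - root_p). *)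
Lemma supertrace_extremal x f : (forall p, J p -> x != root_at p) ->
  resolvent rho J x (ev X f) ->
  (1 - \sum_(p : idx | J p) sg (e p) *: ev X f p p) *m v =
  (\prod_(p : idx | J p) ((x - root_at p - sg (e p)) / (x - root_at p))) *: v.
Proof.
move=> xr hR; set R := ev X f in hR *.
(* Induction on the number k of last positions, in the order [o], that the sum includes. *)
have partial k : (k <= (m + n).+1)%N ->
    v - \sum_(p : idx | J p && ((m + n).+1 - k <= o p)%N) sg (e p) *: (R p p *m v)
    = (\prod_(p : idx | J p && ((m + n).+1 - k <= o p)%N)
         ((x - root_at p - sg (e p)) / (x - root_at p))) *: v.
  elim: k => [_|k IH lk].
    rewrite subn0 !big_pred0 ?subr0 ?scale1r // => p;
      by rewrite leqNgt ltn_ord andbF.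
  pose t := ((m + n).+1 - k.+1)%N; rewrite -/t.
  have tE : ((m + n).+1 - k = t.+1)%N by rewrite /t subnSK.
  have lt : (t < (m + n).+1)%N by rewrite /t ltn_subrL.
  pose p0 := o (Ordinal lt).
  have oE p : (t <= o p)%N = (p == p0) || (t < o p)%N.
    by rewrite leq_eqVlt /p0 -(inj_eq (inv_inj oK)) oK -val_eqE eq_sym.
  have {IH} := IH (ltnW lk); rewrite tE => IH.
  have [Jp0|nJ] := boolP (J p0); last first.
    rewrite (eq_bigl (fun p => J p && (t < o p)%N)) => [|p]; last first.
      by rewrite oE; case: eqP => [->|//]; rewrite (negPf nJ).
    rewrite [in RHS](eq_bigl (fun p => J p && (t < o p)%N)) => [//|p].
    by rewrite oE; case: eqP => [->|//]; rewrite (negPf nJ).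
  have condE p : (J p && (t <= o p)%N) && (p != p0) = J p && (t < o p)%N.
    rewrite oE; have [->|_] := eqVneq p p0; last by rewrite andbT.
    by rewrite /p0 oK ltnn !andbF.
  have cond0 : J p0 && (t <= o p0)%N by rewrite Jp0 /p0 oK leqnn.
  rewrite (bigD1 p0) //= [in RHS](bigD1 p0) //=.
  rewrite (eq_bigl _ _ condE) [in RHS](eq_bigl _ _ condE).
  have := resolvent_diag Jp0 hR; rewrite -/R.
  rewrite {2}/p0 oK /= IH => h0.
  have nz : x - root_at p0 != 0 by rewrite subr_eq0 xr.
  have -> : R p0 p0 *m v = (x - root_at p0)^-1 *: ((x - root_at p0) *: (R p0 p0 *m v)).
    by rewrite scalerA mulVf // scale1r.
  rewrite h0 opprD addrCA IH.
  set q := \prod_(p | _) _; rewrite !scalerA -scaleNr -scalerDl; congr (_ *: _).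
  by field.
have condT : (fun p : idx => J p && (0 <= o p)%N) =1 J by move=> p; rewrite andbT.
have := partial _ (leqnn _); rewrite subnn (eq_bigl _ _ condT).
rewrite [in RHS](eq_bigl _ _ condT) => <-.
rewrite mulmxBl mul1mx mulmx_suml; congr (_ - _).
by apply: eq_bigr => p _; rewrite scalemxAl.
Qed.

End Vector.
End Extremal.

(** * Polynomials on sequences of points *)

Lemma eventually_nonroot (h : {poly C}) : h != 0 ->
  exists K : nat, forall k : nat, h.[(K + k)%:R] != 0.
Proof.
have [s] := ubnP (size h); elim: s h => // s IH h sh h0.
have [[k rk]|nr] := Classical_Prop.classic (exists k : nat, root h k%:R); last first.
  exists 0%N => k; apply/negP => rk; apply: nr; exists (0 + k)%N; exact: rk.
case/factor_theorem: rk => q hq; have q0 : q != 0.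
  by apply: contraNneq h0 => q0; rewrite hq q0 mul0r.
have [|K HK] := IH q _ q0.
  by move: sh; rewrite hq size_Mmonic ?monicXsubC // size_XsubC addn2.
(* The shift by [k.+1] moves the tail past the root k that was divided out. *)
exists (K + k.+1)%N => j; rewrite hq hornerM mulf_neq0 //.
  by rewrite -addnA HK.
rewrite !hornerE subr_eq0 eqr_nat gtn_eqF //.
by rewrite addnS addSn ltnS -addnA addnCA leq_addr.
Qed.

Lemma poly_zero_on_seq (h : {poly C}) (x : nat -> C) : injective x ->
  (forall k, h.[x k] = 0) -> h = 0.
Proof.
move=> injx hx; apply: (@roots_geq_poly_eq0 _ _ (map x (iota 0 (size h)))).
- by apply/allP => _ /mapP[k _ ->]; apply/eqP.
- by rewrite map_inj_uniq // iota_uniq.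
by rewrite size_map size_iota.
Qed.

(* The polynomials [drop_poly j.+1 f], for j < deg f, have pairwise distinct
   degrees. *)
Lemma drop_poly_free r (f : {poly C}) (y : nat -> 'cV[C]_r) (x : nat -> C) :
  injective x ->
  (forall k, \sum_(j < size f) (drop_poly j.+1 f).[x k] *: y j = 0) ->
  forall j, (j.+1 < size f)%N -> y j = 0.
Proof.
move=> injx sum0; elim/ltn_ind => j IH ltj; apply/matrixP => a b; rewrite mxE.
have h0 : \sum_(i < size f) y i a b *: drop_poly i.+1 f = 0.
  apply: (poly_zero_on_seq injx) => k.
  have /matrixP/(_ a b) := sum0 k; rewrite summxE [RHS]mxE => h.
  rewrite -[RHS]h horner_sum.
  by apply: eq_bigr => i _; rewrite mxE hornerZ mulrC.
have := congr1 (fun q : {poly C} => q`_(size f - j.+2)) h0.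
rewrite coef_sum coef0 (bigD1 (Ordinal (ltnW ltj))) //= big1 ?addr0.
  rewrite coefZ coef_drop_poly => /eqP; rewrite mulf_eq0 => /orP[/eqP //|].
  rewrite (_ : (_ + _)%N = (size f).-1); last first.
    by move: ltj; set sz := size f; move: sz => sz; lia.
  rewrite -lead_coefE lead_coef_eq0 => /eqP f0.
  by rewrite f0 size_poly0 in ltj.
move=> i; rewrite -val_eqE /= => nij; rewrite coefZ.
have [lij|leji] := ltnP i j; first by rewrite (IH i lij (leq_ltn_trans lij (ltnW ltj))) mxE mul0r.
rewrite coef_drop_poly nth_default ?mulr0 //.
have ltji : (j < i)%N by rewrite ltn_neqAle eq_sym nij.
by move: ltji ltj; set sz := size f; move: sz (i : nat) => sz k /=; lia.
Qed.

(** * Interpolation and moments *)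

Section Lagrange.
Variables (n : nat) (b : 'I_n.+1 -> C).
Hypothesis binj : injective b.

Definition node_poly (s : 'I_n.+1) : {poly C} :=
  \prod_(k | k != s) ('X - (b k)%:P).

Definition all_nodes : {poly C} := \prod_k ('X - (b k)%:P).

Lemma all_nodesE s : all_nodes = node_poly s * ('X - (b s)%:P).
Proof. by rewrite /all_nodes (bigD1 s) //= mulrC. Qed.

Lemma size_all_nodes : size all_nodes = n.+2.
Proof. by rewrite size_prod_XsubC /index_enum -enumT size_enum_ord. Qed.

Lemma monic_node_poly s : node_poly s \is monic.
Proof. exact: monic_prod_XsubC. Qed.

Lemma size_node_poly s : size (node_poly s) = n.+1.
Proof.
have := size_all_nodes.
rewrite (all_nodesE s) size_Mmonic ?monicXsubC ?monic_neq0 ?monic_node_poly //.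
by rewrite size_XsubC addn2 => -[].
Qed.

Lemma node_poly_root s k : k != s -> (node_poly s).[b k] = 0.
Proof.
by move=> nks; rewrite /node_poly horner_prod (bigD1 k) //= !hornerE subrr mul0r.
Qed.

Lemma node_poly_neq0 s : (node_poly s).[b s] != 0.
Proof.
rewrite /node_poly horner_prod; apply/prodf_neq0 => k nks.
by rewrite !hornerE subr_eq0 (inj_eq binj) eq_sym.
Qed.

Lemma lagrange_interpolation (p : {poly C}) : (size p <= n.+1)%N ->
  p = \sum_k (p.[b k] / (node_poly k).[b k]) *: node_poly k.
Proof.
move=> sp; apply/eqP; rewrite -subr_eq0; apply/eqP.
apply: (@roots_geq_poly_eq0 _ _ (map b (enum 'I_n.+1))).
- apply/allP => _ /mapP[k _ ->]; apply/eqP; rewrite hornerD hornerN horner_sum.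
  rewrite (bigD1 k) //= hornerZ mulfVK ?node_poly_neq0 // big1 ?addr0 ?subrr //.
  by move=> i nik; rewrite hornerZ (@node_poly_root i k) ?mulr0 // eq_sym.
- by rewrite map_inj_uniq // enum_uniq.
rewrite size_map size_enum_ord (leq_trans (size_polyD _ _)) // geq_max sp.
rewrite size_polyN (leq_trans (size_sum _ _ _)) //; apply/bigmax_leqP => k _.
by rewrite (leq_trans (size_scale_leq _ _)) // size_node_poly.
Qed.

(* If the moments v_j have generating function (p / prod_k (X - b_k)) z at
   infinitely many points, they are power sums weighted by its residues; the
   leading coefficient of p forces z = v_0. *)
Lemma moments_of_resolvent r (p g : {poly C}) (v : nat -> 'cV[C]_r) z
    (x : nat -> C) : injective x -> (forall k i, x k != b i) -> g != 0 -> p \is monic -> size p = n.+1 ->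
  (forall k, \sum_(j < size (g * all_nodes))
      (drop_poly j.+1 (g * all_nodes)).[x k] *: v j = (g * p).[x k] *: z) ->
  forall h : {poly C}, (size h <= n.+1)%N ->
  \sum_(j < n.+1) h`_j *: v j =
  (\sum_k p.[b k] / (node_poly k).[b k] * h.[b k]) *: v 0%N.
Proof.
move=> injx xb g0 pmon sp hv; set f := g * all_nodes in hv.
pose res k := p.[b k] / (node_poly k).[b k].
have sf : (n.+1 < size f)%N.
  have := size_all_nodes; have := monic_prod_XsubC (index_enum 'I_n.+1) predT b.
  rewrite -/all_nodes => mon sz; rewrite /f size_Mmonic // sz.
  by have := g0; rewrite -size_poly_gt0; lia.
have pE := lagrange_interpolation (eq_leq sp).
(* The divided difference of f evaluated at its root b_i is f(x_k) / (x_k - b_i). *)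
have quot i k : \sum_(j < size f) (drop_poly j.+1 f).[x k] * b i ^+ j =
    (g * node_poly i).[x k].
  have := congr1 (horner^~ (b i)) (quot_atP (x k) (leqnn (size f))).
  rewrite hornerM !hornerD !hornerN !hornerC hornerX {1}/quot_at horner_poly => h.
  have nz : x k - b i != 0 by rewrite subr_eq0.
  apply: (mulIf nz); rewrite h.
  by rewrite /f (all_nodesE i) !hornerM !hornerXsubC subrr !mulr0 subr0 mulrA.
(* The weighted power sums times z satisfy the same equations as the v_j, so [drop_poly_free]
   applies to the difference. *)
have vE j : (j < n.+1)%N -> v j = (\sum_i res i * b i ^+ j) *: z.
  move=> lj; apply/eqP; rewrite -subr_eq0; apply/eqP.
  apply: (@drop_poly_free _ f (fun j => v j - (\sum_i res i * b i ^+ j) *: z) x injx).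
    move=> k; under eq_bigr do rewrite scalerBr scalerA.
    rewrite sumrB -scaler_suml hv [in (g * p)]pE; apply/eqP; rewrite subr_eq0; apply/eqP.
    congr (_ *: _); rewrite mulr_sumr horner_sum.
    under [RHS]eq_bigr do rewrite mulr_sumr.
    rewrite exchange_big /=; apply: eq_bigr => i _.
    rewrite -scalerAr hornerZ -quot mulr_sumr; apply: eq_bigr => l _.
    by rewrite /res; ring.
  exact: leq_ltn_trans lj sf.
(* Coefficient of degree n in Lagrange's formula, where p and all node polynomials are monic of
   degree n. *)
have res1 : \sum_i res i = 1.
  have := congr1 (fun q : {poly C} => q`_n) pE; rewrite coef_sum.
  have -> : p`_n = 1 by have /monicP := pmon; rewrite lead_coefE sp.
  move=> ->; apply: eq_bigr => i _; rewrite coefZ.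
  have /monicP := monic_node_poly i; rewrite lead_coefE size_node_poly /= => ->.
  by rewrite mulr1.
move=> h sh; under eq_bigr => j _ do rewrite vE // scalerA mulr_sumr.
rewrite -scaler_suml exchange_big /=; congr (_ *: _); last first.
  by rewrite vE //; under eq_bigr do rewrite expr0 mulr1; rewrite res1 scale1r.
apply: eq_bigr => i _; rewrite -/(res i) (horner_coef_wide _ sh) mulr_sumr.
by apply: eq_bigr => j _; ring.
Qed.

End Lagrange.

(** * Commutation properties of the corner entry and of the supertrace *)

Section Corner.
Variables (m n d : nat).
Local Notation idx := 'I_(m + n).+1.
Local Notation op := 'M[C]_d.+1.
Local Notation vec := 'cV[C]_d.+1.
Local Notation opmx := 'M[op]_((m + n).+1).
Hypothesis m_gt0 : (0 < m)%N.
Variables (rho : idx -> idx -> op) (P : op).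
Hypothesis rhoP : is_super_rep rho.
Hypothesis gradP : is_grading rho P.
Local Notation e p := (par m p.+1).
Local Notation sg := sgnb.
Local Notation N := (@ord_max (m + n)).
Local Notation alli := (@full_index m n).
Local Notation subi := (@sub_index m n).

Lemma ev_entry_comm (J : pred idx) (Z : op) f (p q : idx) :
  (forall r s, J r -> J s -> Z * rho r s = rho r s * Z) ->
  ev (trunc rho J) f p q * Z = Z * ev (trunc rho J) f p q.
Proof.
move=> cZ; pose S : opmx := Z%:M.
have SM (X : opmx) r s : (S * X) r s = Z * X r s.
  rewrite mulmx_entry (bigD1 r) //= big1 ?addr0 => [|i ni].
    by rewrite mxE eqxx mulr1n.
  by rewrite mxE eq_sym (negPf ni) mul0r.
have MS (X : opmx) r s : (X * S) r s = X r s * Z.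
  rewrite mulmx_entry (bigD1 s) //= big1 ?addr0 => [|i ni].
    by rewrite mxE eqxx mulr1n.
  by rewrite mxE (negPf ni) mulr0.
have SJ : trunc rho J * S = S * trunc rho J.
  apply/matrixP => r s; rewrite SM MS mxE.
  case: ifP => [/andP[Jr Js]|_]; last by rewrite mul0r mulr0.
  by rewrite -scalerAl -scalerAr cZ.
have /matrixP/(_ p q) := ev_comm f SJ.
by rewrite SM MS.
Qed.

(** B commutes with the diagonal matrix of entries (-1)^(p) P, which is [sdiag] for the odd pair
    formed by the first and last indices; on diagonal entries the signs cancel. *)
Lemma ev_diag_grading f (p : idx) :
  P * ev (trunc rho alli) f p p = ev (trunc rho alli) f p p * P.
Proof.
have [_ PG] := gradP.
have e0 : e (@ord0 (m + n)) = false by rewrite /par ltnNge m_gt0.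
pose S := sdiag ord0 N P.
have /matrixP/(_ p p) : ev (trunc rho alli) f * S = S * ev (trunc rho alli) f.
  apply: ev_comm; apply/matrixP => r s; rewrite mul_sdiagE sdiag_mulE.
  rewrite trunc_allE e0 par_max /= -scalerAl -scalerAr.
  have := PG r s; rewrite mulmxE => ->.
  by move: (P * rho r s) => z; mx_ring.
rewrite mul_sdiagE sdiag_mulE => /(congr1 (fun z => sg ((e (@ord0 (m + n)) (+) e N) && e p) *: z)).
by rewrite !sgK.
Qed.

(** By covariance only the summands p = b and p = a contribute to the bracket with E_ab, namely
    M^a_b with opposite signs. *)
Lemma supertrace_central (M : opmx) (a b : idx) : cov_at rho a b M ->
  (\sum_(p : idx) sg (e p) *: M p p) * rho a b =
  rho a b * (\sum_(p : idx) sg (e p) *: M p p).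
Proof.
move=> cov; apply/esym/eqP; rewrite -subr_eq0; apply/eqP.
rewrite mulr_sumr mulr_suml -sumrB.
have E (p : idx) : rho a b * (sg (e p) *: M p p) - sg (e p) *: M p p * rho a b =
  sg (e a) *: ((p == b)%:R *: M a p - (p == a)%:R *: M p b).
  have h := cov p p; rewrite -scalerAr -scalerAl.
  refine (@lin_conseq _ _ (sg (e p) * sg ((e a (+) e b) && e p)) _ _ _ _ h _).
  move: (rho a b * M p p) (M p p * rho a b) => u t.
  by have [->|_] := eqVneq p b; have [->|_] := eqVneq _ a; mx_ring.
under eq_bigr do rewrite E.
rewrite -scaler_sumr sumrB (bigD1 b) //= eqxx scale1r big1 => [|i ni]; last first.
  by rewrite (negPf ni) scale0r.
rewrite addr0 (bigD1 a) //= eqxx scale1r big1 => [|i ni]; last first.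
  by rewrite (negPf ni) scale0r.
by rewrite addr0 subrr scaler0.
Qed.

Lemma corner_comm f (p q : idx) : p != N -> q != N ->
  rho p q * ev (trunc rho alli) f N N = ev (trunc rho alli) f N N * rho p q.
Proof.
move=> Np Nq; have := @cov_ev _ _ _ _ rhoP alli f p q isT isT N N.
rewrite ![N == _]eq_sym (negPf Np) (negPf Nq) !scale0r !subr0.
by move=> /(congr1 (fun z => sg ((e p (+) e q) && e N) *: z)); rewrite !sgK.
Qed.

(** * The difference equation and its solution on an extremal vector *)

Section Value.
Variables (o : idx -> idx) (v w : vec) (lt l : idx -> C) (zeta : idx -> C).
Hypothesis oK : involutive o.
Hypothesis vdiag : forall p, rho p p *m v = lt p *: v.
Hypothesis vup : forall p q, (o p < o q)%N -> rho p q *m v = 0.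
Hypothesis schur : forall (Z : op) (k : C),
  (forall p q, Z * rho p q = rho p q * Z) -> Z * P = P * Z ->
  Z *m v = k *: v -> forall u : vec, Z *m u = k *: u.
Hypothesis wdiag : forall p, subi p -> rho p p *m w = l p *: w.
Hypothesis wup : forall p q, subi p -> subi q -> (o p < o q)%N ->
  rho p q *m w = 0.
Let b := root_at alli o lt.
Let a := root_at subi o l.
Hypothesis binj : injective b.
(** The zeros of the numerator of c(x). In the last case zeta_p = b_p, and the factor cancels
    against a pole. *)
Hypothesis zetaP : forall p, subi p ->
  if e p then zeta p = a p - 1
  else (a p = b p /\ zeta p = a p + 1) \/ (a p = b p + 1 /\ zeta p = b p).

Local Notation B := (trunc rho alli).
Local Notation A := (trunc rho subi).
Let uB x := \prod_p ((x - b p - sg (e p)) / (x - b p)).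
Let uA x := \prod_(p : idx | subi p) ((x - a p - sg (e p)) / (x - a p)).
Let kappa x := \prod_(p : idx | subi p) ((x - zeta p) / (x - b p)) / (x - b N).

Lemma sub_index_neq p : subi p = (p != N).
Proof. by rewrite /sub_index -val_eqE /= ltn_neqAle -ltnS ltn_ord andbT. Qed.

(** [corner_supertrace] applied to w. The supertrace of G commutes with c(x), since c(x) commutes
    with gl(m|n), and acts on w through [uA]; that of R is central, so its value [uB] on v holds
    everywhere by [schur]. *)
Lemma corner_step f g x : ev B f = 0 -> ev A g = 0 ->
  f.[x] != 0 -> f.[x + 1] != 0 -> g.[x + 1] != 0 ->
  (forall p, x != b p) -> (forall p, subi p -> x + 1 != a p) ->
  let c y := ev B (f.[y]^-1 *: quot_at (size f) f y) N N in
  uA (x + 1) *: (c x *m w) = uB x *: (c (x + 1) *m w).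
Proof.
move=> fB gA fx fx1 gx1 xb x1a c.
have hR := ev_resolvent fB fx (leqnn _).
have hR1 := ev_resolvent fB fx1 (leqnn _).
have hG := ev_resolvent gA gx1 (leqnn _).
have covR : forall r s, cov_at rho r s (ev B (f.[x]^-1 *: quot_at (size f) f x)).
  by move=> r s; apply: cov_ev.
have := corner_supertrace hR hR1 hG covR.
set R := ev B _ in hR covR *; set R1 := ev B _; set G := ev A _.
move=> /(congr1 (fun z : op => z *m w)).
have -> : (1 - \sum_(p : idx | subi p) sg (e p) *: G p p) * R N N =
          R N N * (1 - \sum_(p : idx | subi p) sg (e p) *: G p p).
  rewrite mulrBl mulrBr mul1r mulr1 mulr_suml mulr_sumr; congr (_ - _).
  apply: eq_bigr => p _; rewrite -scalerAl -scalerAr; congr (_ *: _).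
  apply: ev_entry_comm => r s; rewrite !sub_index_neq => Jr Js.
  exact/esym/corner_comm.
rewrite !op_mulE (supertrace_extremal rhoP oK wdiag wup _ hG); last first.
  by move=> p Jp; apply: x1a.
rewrite -scalemxAr => ->; apply: schur.
- move=> p q; rewrite mulrBl mulrBr mul1r mulr1 supertrace_central //.
- rewrite mulrBl mulrBr mul1r mulr1 mulr_suml mulr_sumr; congr (_ - _).
  by apply: eq_bigr => p _; rewrite -scalerAl -scalerAr ev_diag_grading.
by apply: (@supertrace_extremal _ _ _ _ rhoP alli o v lt oK _ _ x _ _ hR) => p *;
  [apply: vdiag | apply: vup | apply: xb].
Qed.

(** Checked factor by factor in the three cases of [zetaP]; the factor of [uB] at the odd index N
    turns 1 / (x + 1 - b_N) into 1 / (x - b_N). *)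
Lemma kappa_step x : (forall p, x != b p) -> (forall p, x + 1 != b p) ->
  (forall p, subi p -> x + 1 != a p) ->
  uA (x + 1) * kappa x = uB x * kappa (x + 1).
Proof.
move=> xb x1b x1a; rewrite /uA /uB /kappa [in RHS](bigD1 N) //= par_max.
rewrite [X in _ = _ * X * _](eq_bigl subi) => [|p]; last by rewrite sub_index_neq.
set U := \prod_(p | _) _; set V := \prod_(p | _) _.
set U1 := (X in _ = _ * X * _); set V1 := (X in _ = _ * (X / _)).
have E : U * V = U1 * V1.
  rewrite -!big_split /=; apply: eq_bigr => p Jp.
  have n1 : x - b p != 0 by rewrite subr_eq0.
  have n2 : x + 1 - b p != 0 by rewrite subr_eq0.
  have n3 : x + 1 - a p != 0 by rewrite subr_eq0 x1a.
  have := zetaP Jp; case: (e p) => [->|[[ab ->]|[ab ->]]]; rewrite /sgnb.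
  - by field; rewrite n1 n2 n3.
  - by rewrite ab; field; rewrite n1 n2.
  have n1' : x - b p != 0 by [].
  by move: n3; rewrite ab => n3; field; rewrite n1 n2 ?n3.
have n1 : x - b N != 0 by rewrite subr_eq0.
have n2 : x + 1 - b N != 0 by rewrite subr_eq0.
rewrite mulrA E /sgnb; field; by rewrite n1 n2.
Qed.

Lemma card_sub_index : #|subi| = (m + n)%N.
Proof.
have -> : #|subi| = #|predC1 N| by apply: eq_card => p; rewrite !inE -sub_index_neq.
by rewrite cardC1 card_ord.
Qed.

Lemma prod_XsubC_neq0 (q : pred idx) (F : idx -> C) :
  \prod_(r | q r) ('X - (F r)%:P) != 0.
Proof. by apply/prodf_neq0 => r _; rewrite polyXsubC_eq0. Qed.

Lemma prod_XsubC_horner (q : pred idx) (F : idx -> C) y :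
  (\prod_(r | q r) ('X - (F r)%:P)).[y] = \prod_(r | q r) (y - F r).
Proof. by rewrite horner_prod; apply: eq_bigr => r _; rewrite hornerXsubC. Qed.

Lemma hornerM5_neq0 (q1 q2 q3 q4 q5 : {poly C}) y :
  (q1 * q2 * q3 * q4 * q5).[y] != 0 ->
  [&& q1.[y] != 0, q2.[y] != 0, q3.[y] != 0, q4.[y] != 0 & q5.[y] != 0].
Proof. by rewrite !hornerM !mulf_eq0 !negb_or -!andbA. Qed.

(** Along a tail of integers c(x) w and [kappa x] obey the same recurrence, so their quotient is a
    constant vector. The moments of c(x) then determine the corner of every polynomial in B of
    degree at most m + n. *)
Lemma corner_value s :
  ev B (node_poly b s) N N *m w = (\prod_(r | subi r) (b s - zeta r)) *: w.
Proof.
have [fB fB0 evfB] := annihilating_poly B.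
have [g g0 evg] := annihilating_poly A.
(* The extra factor gives f the shape required by [moments_of_resolvent] and keeps the sample points
   away from the b_r. *)
pose f := fB * all_nodes b.
have evf : ev B f = 0 by rewrite rmorphM /= [ev B fB]evfB mul0r.
pose p := \prod_(r | subi r) ('X - (zeta r)%:P).
have pX y : p.[y] = \prod_(r | subi r) (y - zeta r) by exact: prod_XsubC_horner.
(* All points to be avoided. A full tail of integers avoids them, so x and x + 1 are admissible
   together. *)
pose h := f * g * p * \prod_(r | subi r) ('X - (a r)%:P)
  * \prod_(r | subi r) ('X - (a r + sg (e r))%:P).
have f0 : f != 0 by rewrite mulf_neq0 ?prod_XsubC_neq0.
have h0 : h != 0 by rewrite !mulf_neq0 ?prod_XsubC_neq0.
have [K HK] := eventually_nonroot h0.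
pose x k : C := (K + k)%:R.
have xS k : x k + 1 = x k.+1 by rewrite natr1 -addnS.
have injx : injective x by move=> i j /eqP; rewrite eqr_nat eqn_add2l => /eqP.
have good k : [&& f.[x k] != 0, g.[x k] != 0, p.[x k] != 0,
    \prod_(r | subi r) (x k - a r) != 0
    & \prod_(r | subi r) (x k - (a r + sg (e r))) != 0].
  by have := hornerM5_neq0 (HK k); rewrite !prod_XsubC_horner.
have fx k : f.[x k] != 0 by case/and5P: (good k).
have gx k : g.[x k] != 0 by case/and5P: (good k).
have px k r : subi r -> x k != zeta r.
  case/and5P: (good k) => _ _; rewrite pX => /prodf_neq0 H _ _ /H.
  by rewrite subr_eq0.
have xa k r : subi r -> x k != a r.
  by case/and5P: (good k) => _ _ _ /prodf_neq0 H _ /H; rewrite subr_eq0.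
have xas k r : subi r -> x k - a r - sg (e r) != 0.
  by case/and5P: (good k) => _ _ _ _ /prodf_neq0 H /H; rewrite opprD addrA.
have nodes0 k : (all_nodes b).[x k] != 0.
  by have := fx k; rewrite /f hornerM mulf_eq0 negb_or => /andP[].
have xb k r : x k != b r.
  have := nodes0 k.
  by rewrite /all_nodes prod_XsubC_horner => /prodf_neq0/(_ r isT); rewrite subr_eq0.
have kappa0 k : kappa (x k) != 0.
  rewrite /kappa mulf_neq0 ?invr_eq0 ?subr_eq0 //; apply/prodf_neq0 => r Jr.
  by rewrite mulf_neq0 ?invr_eq0 ?subr_eq0 ?px.
pose c y := ev B (f.[y]^-1 *: quot_at (size f) f y) N N.
have [z cz] : exists z, forall k, c (x k) *m w = kappa (x k) *: z k.
  exists (fun k => (kappa (x k))^-1 *: (c (x k) *m w)) => k.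
  by rewrite scalerA mulfV ?scale1r.
have zS k : z k = z k.+1.
  have := @corner_step f g (x k) evf evg (fx k).
  rewrite xS => /(_ (fx k.+1) (gx k.+1) (xb k) (fun r Jr => xa k.+1 r Jr)).
  rewrite /= -/(c _) -/(c _) !cz !scalerA.
  have := @kappa_step (x k) (xb k); rewrite xS => /(_ (xb k.+1) (fun r Jr => xa k.+1 r Jr)) <-.
  have nz : uA (x k.+1) * kappa (x k) != 0.
    rewrite mulf_neq0 //; apply/prodf_neq0 => r Jr.
    by rewrite mulf_neq0 ?invr_eq0 ?xas // subr_eq0 xa.
  by move/(scalerI nz).
have zE k : z k = z 0%N by elim: k => // k IH; rewrite -zS.
pose mom j := ev B 'X^j N N *m w.
have kappaE k : kappa (x k) = p.[x k] / (all_nodes b).[x k].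
  have -> : (all_nodes b).[x k] = \prod_(r | subi r) (x k - b r) * (x k - b N).
    rewrite /all_nodes prod_XsubC_horner (bigD1 N) //= mulrC; congr (_ * _).
    by apply: eq_bigl => r; rewrite sub_index_neq.
  by rewrite /kappa pX big_split /= prodfV invfM mulrA.
(* Multiplying c(x_k) w = kappa(x_k) z by f(x_k) clears the denominators. *)
have hv k : \sum_(j < size f) (drop_poly j.+1 f).[x k] *: mom j =
    (fB * p).[x k] *: z 0%N.
  have -> : (fB * p).[x k] *: z 0%N = f.[x k] *: (c (x k) *m w).
    rewrite cz zE scalerA kappaE; congr (_ *: _).
    by rewrite [RHS]mulrA /f 2!hornerM mulrAC mulfK.
  rewrite scalemxAl /c evZ scalerA mulfV // scale1r.
  rewrite (ev_coef B (n := size f)) ?size_poly // mulmx_suml.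
  by apply: eq_bigr => j _; rewrite coef_poly ltn_ord scalemxAl.
have sp : size p = (m + n).+1.
  rewrite /p (eq_bigl (fun r => r \in subi)) // -big_enum size_prod_XsubC.
  by rewrite -cardE card_sub_index.
have pmon : p \is monic by apply: monic_prod_XsubC.
have := @moments_of_resolvent _ b binj _ p fB mom (z 0%N) x injx xb fB0 pmon sp hv.
move=> /(_ (node_poly b s)); rewrite size_node_poly => /(_ (leqnn _)).
have -> : mom 0%N = w by rewrite /mom expr0 rmorph1 mxE eqxx mul1mx.
rewrite (ev_coef B (n := (m + n).+1)) ?size_node_poly // mulmx_suml.
move=> hm; transitivity (\sum_(j < (m + n).+1) (node_poly b s)`_j *: mom j).
  by apply: eq_bigr => j _; rewrite scalemxAl.
rewrite hm; congr (_ *: _); rewrite (bigD1 s) //= big1 ?addr0 => [|k nks].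
  by rewrite divfK ?node_poly_neq0 ?pX.
by rewrite (@node_poly_root _ b s k) ?mulr0.
Qed.

End Value.

End Corner.

(** * Weights, heights and the branching rule *)

Lemma int_shift_l (z u w t : int) : z + (u - w) + (t - u) = z + (t - w).
Proof. ring. Qed.

Lemma int_shift_r (z u w t : int) : z + (u - w) + (w - t) = z + (u - t).
Proof. ring. Qed.

Section Branching.
Variables (m n d : nat).
Local Notation idx := 'I_(m + n).+1.
Local Notation op := 'M[C]_d.+1.
Local Notation vec := 'cV[C]_d.+1.
Variables (rho : idx -> idx -> op) (P : op).
Hypothesis rhoP : is_super_rep rho.
Hypothesis gradP : is_grading rho P.
Hypothesis irrV : irreducible_rep rho P.
Local Notation e p := (par m p.+1).
Local Notation sg := sgnb.
Local Notation N := (@ord_max (m + n)).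
Local Notation subi := (@sub_index m n).

Lemma rho_comm_vec p q r s (x : vec) : rho p q *m (rho r s *m x) =
  sg ((e p (+) e q) && (e r (+) e s)) *: (rho r s *m (rho p q *m x))
  + ((q == r)%:R *: (rho p s *m x)
     - sg ((e p (+) e q) && (e r (+) e s)) *: ((p == s)%:R *: (rho r q *m x))).
Proof.
by rewrite -!op_mulE rho_comm // mulmxDl mulmxBl -!scalemxAl.
Qed.

Lemma sgK_vec (b : bool) (z : vec) : sg b *: (sg b *: z) = z.
Proof. by rewrite scalerA -expr2 sqrr_sign scale1r. Qed.

Lemma rho_grading p q (x : vec) :
  rho p q *m (P *m x) = sg (e p (+) e q) *: (P *m (rho p q *m x)).
Proof. by have [_ PG] := gradP; rewrite mulmxA PG -scalemxAl mulmxA. Qed.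

(** The eigenspace of Z for k is a graded invariant subspace containing v. *)
Lemma schur_irreducible (v : vec) (Z : op) (k : C) : v != 0 ->
  (forall p q, Z * rho p q = rho p q * Z) -> Z * P = P * Z ->
  Z *m v = k *: v -> forall u : vec, Z *m u = k *: u.
Proof.
move=> v0 Zrho ZP Zv u.
have [] // := irrV (S := fun u => Z *m u = k *: u).
- split; first by rewrite mulmx0 scaler0.
  split=> [x y Zx Zy|c x Zx]; first by rewrite mulmxDr Zx Zy scalerDr.
  by rewrite -scalemxAr Zx !scalerA mulrC.
- by move=> x Zx; rewrite -op_mulE ZP op_mulE Zx scalemxAr.
- by move=> p q x _ Zx; rewrite -op_mulE Zrho op_mulE Zx scalemxAr.
by move=> /(_ v Zv) v00; rewrite v00 eqxx in v0.
Qed.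

(** A grading element: E_pq shifts its eigenvalue by q - p, so raising operators increase it. *)
Definition height : op := \sum_(p : idx) (m + n - p)%:R *: rho p p.

Definition is_weight (x : vec) (mu : idx -> C) := forall p, rho p p *m x = mu p *: x.

Definition is_singular (x : vec) := forall p q : idx, (p < q)%N -> rho p q *m x = 0.

Lemma height_weight x mu : is_weight x mu ->
  height *m x = (\sum_(p : idx) (m + n - p)%:R * mu p) *: x.
Proof.
move=> wx; rewrite mulmx_suml scaler_suml; apply: eq_bigr => p _.
by rewrite -scalemxAl wx scalerA.
Qed.

Lemma weight_comm p q r (x : vec) : rho r r *m (rho p q *m x) =
  rho p q *m (rho r r *m x) + ((r == p)%:R - (r == q)%:R) *: (rho p q *m x).
Proof.
rewrite rho_comm_vec addbb.
by have [->|_] := eqVneq r p; have [->|_] := eqVneq _ q; mx_ring.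
Qed.

Lemma weight_step p q r (x : vec) (c : C) : rho r r *m x = c *: x ->
  rho r r *m (rho p q *m x) = (c + ((r == p)%:R - (r == q)%:R)) *: (rho p q *m x).
Proof. by move=> rx; rewrite weight_comm rx -scalemxAr -scalerDl. Qed.

Lemma height_step p q (x : vec) (c : C) : height *m x = c *: x ->
  height *m (rho p q *m x) = (c + (q : nat)%:R - (p : nat)%:R) *: (rho p q *m x).
Proof.
move=> hx.
have E : height *m (rho p q *m x) = rho p q *m (height *m x) +
    \sum_(r : idx) (m + n - r)%:R *: (((r == p)%:R - (r == q)%:R) *: (rho p q *m x)).
  rewrite /height !mulmx_suml mulmx_sumr -big_split; apply: eq_bigr => r _.
  by rewrite -!scalemxAl weight_comm scalerDr -scalemxAr.
rewrite E hx -scalemxAr -addrA scalerDl; congr (_ + _).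
under eq_bigr do rewrite scalerA mulrBr.
rewrite -scaler_suml sumrB; congr (_ *: _).
have S t : \sum_(r : idx) (m + n - r)%:R * (r == t)%:R = (m + n - t)%:R :> C.
  rewrite (bigD1 t) //= eqxx mulr1 big1 ?addr0 // => i /negPf->.
  by rewrite mulr0.
by rewrite !S !natrB -1?ltnS //; ring.
Qed.

(** * Uniqueness of the highest weight *)

Section Descent.
Variables (v : vec) (lt : idx -> C).
Hypothesis vwt : is_weight v lt.
Hypothesis vsing : is_singular v.
Hypothesis v0 : v != 0.
Let h0 := \sum_(p : idx) (m + n - p)%:R * lt p.

(** Irreducibility concerns graded subspaces and v is not assumed homogeneous, so P v serves as a
    second generator at the top. *)
Lemma Pv_weight : is_weight (P *m v) lt.
Proof. by move=> p; rewrite rho_grading addbb /sgnb expr0 scale1r vwt scalemxAr. Qed.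

(* The index is the drop in height from v. *)
Inductive descendant : int -> vec -> Prop :=
| desc_top a c : descendant 0 (a *: v + c *: (P *m v))
| desc_zero z : descendant z 0
| desc_low z (p q : idx) x : (q < p)%N -> descendant z x ->
    descendant (z + ((p : int) - (q : int))) (rho p q *m x)
| desc_add z x y : descendant z x -> descendant z y -> descendant z (x + y)
| desc_scale z c x : descendant z x -> descendant z (c *: x).

Lemma descendant_low z x : descendant z x ->
  (z < 0 -> x = 0) /\ (z = 0 -> exists a c, x = a *: v + c *: (P *m v)).
Proof.
elim=> {z x} [a c|z|z p q x lqp _ [IH _]|z x y _ [IH1 IH2] _ [IH3 IH4]|z c x _ [IH1 IH2]].
- by split=> // _; exists a, c.
- by split=> // _; exists 0, 0; rewrite !scale0r addr0.
- have z0 : z + ((p : int) - (q : int)) <= 0 -> x = 0 by move=> le; apply: IH; lia.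
  split=> [lt0|eq0]; first by rewrite z0 ?mulmx0 // ltW.
  by exists 0, 0; rewrite !scale0r addr0 z0 ?mulmx0 // eq0.
- split=> [lt0|eq0]; first by rewrite IH1 ?IH3 ?addr0.
  have [a [c ->]] := IH2 eq0; have [a' [c' ->]] := IH4 eq0.
  by exists (a + a'), (c + c'); rewrite !scalerDl addrACA.
split=> [lt0|eq0]; first by rewrite IH1 ?scaler0.
by have [a [b ->]] := IH2 eq0; exists (c * a), (c * b); rewrite scalerDr !scalerA.
Qed.

Lemma descendant_height z x : descendant z x -> height *m x = (h0 - z%:~R) *: x.
Proof.
elim=> {z x} [a c|z|z p q x _ _ IH|z x y _ IH1 _ IH2|z c x _ IH].
- rewrite subr0 mulmxDr -!scalemxAr (height_weight vwt) (height_weight Pv_weight).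
  by rewrite scalerDr !scalerA ![_ * h0]mulrC.
- by rewrite mulmx0 scaler0.
- rewrite (height_step _ _ IH); congr (_ *: _).
  have -> : (z + ((p : int) - (q : int)))%:~R = z%:~R + ((p : nat)%:R - (q : nat)%:R) :> C.
    by rewrite rmorphD rmorphB.
  ring.
- by rewrite mulmxDr IH1 IH2 scalerDr.
by rewrite -scalemxAr IH !scalerA mulrC.
Qed.

Lemma descendant_P z x : descendant z x -> descendant z (P *m x).
Proof.
have [PP _] := gradP.
elim=> {z x} [a c|z|z p q x lqp _ IH|z x y _ IH1 _ IH2|z c x _ IH].
- rewrite mulmxDr -!scalemxAr mulmxA PP mul1mx addrC; exact: desc_top.
- by rewrite mulmx0; apply: desc_zero.
- have -> : P *m (rho p q *m x) = sg (e p (+) e q) *: (rho p q *m (P *m x)).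
    by rewrite rho_grading sgK_vec.
  by apply/desc_scale/desc_low.
- by rewrite mulmxDr; apply: desc_add.
by rewrite -scalemxAr; apply: desc_scale.
Qed.

(** E_ab is moved past the lowering operators one at a time; the commutator terms act on a shorter
    descendant and fall under the induction hypothesis. *)
Lemma descendant_rho z x : descendant z x -> forall a b : idx,
  descendant (z + ((a : int) - (b : int))) (rho a b *m x).
Proof.
elim=> {z x} [c1 c2|z|z p q x lqp dx IH|z x y _ IH1 _ IH2|z c x _ IH] a b.
- rewrite mulmxDr -!scalemxAr rho_grading.
  case: (ltngtP a b) => [lab|lba|/val_inj <-].
  + by rewrite vsing // mulmx0 !scaler0 addr0; apply: desc_zero.
  + rewrite -rho_grading; apply: desc_add; apply: desc_scale; apply: desc_low => //.
      by have := desc_top 1 0; rewrite scale1r scale0r addr0.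
    by have := desc_top 0 1; rewrite scale1r scale0r add0r.
  rewrite subrr addbb /sgnb expr0 scale1r vwt -scalemxAr !scalerA; exact: desc_top.
- by rewrite mulmx0; apply: desc_zero.
- rewrite rho_comm_vec; apply: desc_add.
    by apply: desc_scale; rewrite addrAC; apply: desc_low.
  apply: desc_add.
    have [->|_] := eqVneq b p; last by rewrite scale0r; apply: desc_zero.
    rewrite scale1r; rewrite int_shift_l.
    exact: IH.
  rewrite -scaleN1r; do 2 apply: desc_scale.
  have [->|_] := eqVneq a q; last by rewrite scale0r; apply: desc_zero.
  rewrite scale1r; rewrite int_shift_r.
  exact: IH.
- by rewrite mulmxDr; apply: desc_add.
by rewrite -scalemxAr; apply: desc_scale.
Qed.

(* annihilates the part of a descendant lying strictly below the top *)
Fixpoint below (k : nat) : op :=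
  if k is k'.+1 then (height - (h0 - k%:R)%:M) * below k' else 1.

Lemma below_leq k k' (x : vec) : (k <= k')%N -> below k *m x = 0 -> below k' *m x = 0.
Proof.
move=> /subnK <-; elim: (k' - k)%N => // j IH /IH b0.
by rewrite addSn [below _]/= op_mulE b0 mulmx0.
Qed.

Lemma below_eigen k (x : vec) c : height *m x = c *: x ->
  below k *m x = (\prod_(j < k) (c - h0 + j.+1%:R)) *: x.
Proof.
move=> hx; elim: k => [|k IH]; first by rewrite big_ord0 scale1r mul1mx.
rewrite [below _]/= op_mulE IH big_ord_recr /= -scalemxAr mulmxBl hx mul_scalar_mx.
by rewrite -scalerBl scalerA opprB addrCA addrC.
Qed.

Inductive in_span : vec -> Prop :=
| span_desc z x : descendant z x -> in_span x
| span_add x y : in_span x -> in_span y -> in_span (x + y).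

Lemma in_span_all x : in_span x.
Proof.
have [] := irrV (S := in_span).
- split; first exact: (span_desc (desc_zero 0)).
  split; first exact: span_add.
  move=> a u; elim=> {u} [z u du|u w _ IH1 _ IH2].
    by apply: span_desc; apply: desc_scale du.
  by rewrite scalerDr; apply: span_add.
- move=> u; elim=> {u} [z u du|u w _ IH1 _ IH2].
    by apply: span_desc; apply: descendant_P du.
  by rewrite mulmxDr; apply: span_add.
- move=> p q u _; elim=> {u} [z u du|u w _ IH1 _ IH2].
    by apply: span_desc; apply: (descendant_rho du).
  by rewrite mulmxDr; apply: span_add.
- move=> /(_ v) h; have : v = 0.
    by apply: h; apply: (@span_desc 0); have := desc_top 1 0; rewrite scale1r scale0r addr0.
  by move=> v00; move: v0; rewrite v00 eqxx.
by apply.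
Qed.

(** Descendants of drop 0 lie in the span of v and P v, those of positive drop k are killed by
    [below k], and those of negative drop are zero. *)
Lemma top_part x : exists a c k, below k *m (x - (a *: v + c *: (P *m v))) = 0.
Proof.
elim: (in_span_all x) => {x} [z x dx|x y _ [a [c [k bx]]] _ [a' [c' [k' by_]]]].
  have [low top] := descendant_low dx.
  have hx := descendant_height dx.
  case: z dx low top hx => [[|k]|k] dx low top hx.
  - have [//|a [c ->]] := top; exists a, c, 0%N.
    by rewrite subrr mulmx0.
  - exists 0, 0, k.+1; rewrite !scale0r addr0 subr0 (below_eigen _ hx).
    rewrite big_ord_recr /= addrAC subrr sub0r -[_%:~R]/(k.+1%:R) addNr mulr0.
    by rewrite scale0r.
  by exists 0, 0, 0%N; rewrite low // !scale0r addr0 subr0 mulmx0.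
exists (a + a'), (c + c'), (k + k')%N.
have -> : x + y - ((a + a') *: v + (c + c') *: (P *m v)) =
    (x - (a *: v + c *: (P *m v))) + (y - (a' *: v + c' *: (P *m v))).
  by rewrite !scalerDl [X in _ - X]addrACA opprD addrACA.
have b1 := below_leq (leq_addr k' k) bx; have b2 := below_leq (leq_addl k k') by_.
by rewrite mulmxDr b1 b2 addr0.
Qed.

(** [below k] acts by scalars on y and on its top part. If h' differs from h0, the scalar on y must
    vanish, and one of its factors gives h'. If h' = h0, both scalars are the same nonzero number,
    so y is its top part. *)
Lemma height_bound (y : vec) h' : y != 0 -> height *m y = h' *: y ->
  (exists k : nat, h' = h0 - k%:R) /\ (h' = h0 -> exists a c, y = a *: v + c *: (P *m v)).
Proof.
move=> y0 hy; have [a [c [k]]] := top_part y.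
have hx : height *m (a *: v + c *: (P *m v)) = h0 *: (a *: v + c *: (P *m v)).
  by rewrite (descendant_height (desc_top a c)) subr0.
rewrite mulmxBr (below_eigen _ hy) (below_eigen _ hx) => E; split.
  have [->|nh] := eqVneq h' h0; first by exists 0%N; rewrite subr0.
  have : (\prod_(j < k) (h' - h0 + j.+1%:R)) * (h' - h0) == 0.
    have {E} E := subr0_eq E; set A1 := \prod_(j < k) _ in E *.
    have E1 : height *m (A1 *: y) = h0 *: (A1 *: y).
      by rewrite E -scalemxAr hx !scalerA mulrC.
    have : (h' - h0) *: (A1 *: y) = 0.
      by rewrite scalerBl -E1 -scalemxAr hy !scalerA mulrC subrr.
    by move=> /eqP; rewrite scalerA scaler_eq0 (negPf y0) orbF mulrC.
  rewrite mulf_eq0 subr_eq0 (negPf nh) orbF => /prodf_eq0[j _].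
  rewrite addrAC subr_eq0 => /eqP E'; exists j.+1; rewrite -E'.
  by rewrite addrK.
move=> e0; exists a, c; move: E; rewrite e0.
under eq_bigr do rewrite subrr add0r.
move=> /eqP; rewrite -scalerBr scaler_eq0 => /orP[|].
  by move=> /prodf_eq0[j _]; rewrite pnatr_eq0.
by rewrite subr_eq0 => /eqP.
Qed.

End Descent.

(** Each vector bounds the height of the other, so the heights agree; then y lies in the span of v
    and P v. *)
Lemma singular_weight_unique v lt y mu : v != 0 -> is_weight v lt -> is_singular v ->
  y != 0 -> is_weight y mu -> is_singular y -> forall p, mu p = lt p.
Proof.
move=> v0 vwt vs y0 ywt ys p.
have [[k ky] top] := height_bound vwt vs v0 y0 (height_weight ywt).
have [[k' kv] _] := height_bound ywt ys y0 v0 (height_weight vwt).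
have : (k + k')%:R = 0 :> C.
  move: ky kv; set H := \sum_p _; set H' := \sum_p _ => -> E.
  have -> : (k + k')%:R = H' - (H' - k%:R - k'%:R) :> C by rewrite natrD; ring.
  by rewrite -E subrr.
move=> /eqP; rewrite pnatr_eq0 addn_eq0 => /andP[/eqP k0 _].
rewrite k0 subr0 in ky; have [a [c E]] := top ky.
have : mu p *: y = lt p *: y.
  by rewrite -ywt E mulmxDr -!scalemxAr vwt (Pv_weight vwt) scalerDr !scalerA ![_ * lt p]mulrC.
by move=> /eqP; rewrite -subr_eq0 -scalerBl scaler_eq0 (negPf y0) orbF subr_eq0 => /eqP.
Qed.

(** * Monomials in the E_pN applied to a gl(m|n) highest weight vector *)

Section Monomials.
Variables (w : vec) (l : idx -> C).
Hypothesis wwt : is_weight w l.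
Hypothesis wsing : forall p q : idx, subi p -> subi q -> (p < q)%N -> rho p q *m w = 0.
Hypothesis w0 : w != 0.

Definition mono (s : seq idx) : vec := foldr (fun p x => rho p N *m x) w s.

(** The gain in height over w. *)
Definition mono_deg (s : seq idx) : nat := \sum_(p <- s) (m + n - p)%N.

Lemma mono_deg_cons p s : mono_deg (p :: s) = ((m + n - p) + mono_deg s)%N.
Proof. by rewrite /mono_deg big_cons. Qed.

Lemma sub_index_lt p : subi p -> (p < m + n)%N. Proof. by []. Qed.

Definition mono_weight (s : seq idx) (r : idx) : C :=
  l r + (count_mem r s)%:R - (if r == N then (size s)%:R else 0).

Lemma mono_wt s : all subi s -> is_weight (mono s) (mono_weight s).
Proof.
elim: s => [_ r|p s IH /= /andP[Jp Js] r].
  by rewrite /mono_weight /= wwt; case: ifP; rewrite addr0 subr0.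
rewrite (weight_step _ _ (IH Js r)) /mono_weight /= [p == r]eq_sym natrD.
congr (_ *: _); case: (r == N) => /=; last by rewrite mulr0n; ring.
by rewrite -[(size s).+1%:R]natr1 mulr1n; ring.
Qed.

Lemma mono_height s : all subi s -> height *m mono s =
  ((\sum_(p : idx) (m + n - p)%:R * l p) + (mono_deg s)%:R) *: mono s.
Proof.
elim: s => [_|p s IH /= /andP[Jp Js]].
  by rewrite /mono_deg big_nil addr0; apply: height_weight.
rewrite (height_step _ _ (IH Js)) mono_deg_cons; congr (_ *: _).
by rewrite [in RHS]natrD natrB ?(ltnW (sub_index_lt Jp)) //=; ring.
Qed.

(** The height of a nonzero monomial is a root of the characteristic polynomial of [height], by
    Cayley-Hamilton. *)
Lemma mono_bounded : exists K, forall s, all subi s -> (K <= mono_deg s)%N -> mono s = 0.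
Proof.
pose hw := \sum_(p : idx) (m + n - p)%:R * l p.
pose f := char_poly height \Po ('X + hw%:P).
have f0 : f != 0.
  by rewrite -size_poly_gt0 size_comp_poly2 ?size_XaddC // size_char_poly.
have [K HK] := eventually_nonroot f0; exists K => s Js /subnKC lK.
have hs := mono_height Js; rewrite -/hw in hs.
have : (char_poly height).[hw + (mono_deg s)%:R] *: mono s = 0.
  have E q : horner_mx height q *m mono s = q.[hw + (mono_deg s)%:R] *: mono s.
    elim/poly_ind: q => [|q c IH]; first by rewrite rmorph0 horner0 scale0r mul0mx.
    rewrite rmorphD rmorphM /= horner_mx_X horner_mx_C mulmxDl mul_scalar_mx.
    by rewrite op_mulE hs -scalemxAr IH !hornerE scalerA scalerDl mulrC.
  by rewrite -E Cayley_Hamilton mul0mx.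
move=> /eqP; rewrite scaler_eq0 => /orP[|/eqP //].
have := HK (mono_deg s - K)%N; rewrite lK /f horner_comp !hornerE addrC.
by move=> /negPf->.
Qed.

Inductive mono_span (z : nat) : vec -> Prop :=
| ms_zero : mono_span z 0
| ms_mono s : all subi s -> mono_deg s = z -> mono_span z (mono s)
| ms_add x y : mono_span z x -> mono_span z y -> mono_span z (x + y)
| ms_scale c x : mono_span z x -> mono_span z (c *: x).

Lemma mono_span_raise z p x : subi p -> mono_span z x ->
  mono_span ((m + n - p) + z) (rho p N *m x).
Proof.
move=> Jp; elim=> {x} [|s Js sz|x y _ IH1 _ IH2|c x _ IH].
- by rewrite mulmx0; apply: ms_zero.
- apply: (@ms_mono _ (p :: s)); first by rewrite /= Jp.
  by rewrite mono_deg_cons sz.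
- by rewrite mulmxDr; apply: ms_add.
by rewrite -scalemxAr; apply: ms_scale.
Qed.

(** For b = N the monomial gets one more factor. Otherwise E_ab kills w and commutes up to sign with
    each E_pN, except that for p = b the bracket is E_aN. *)
Lemma mono_raise s (a b : idx) : all subi s -> (a < b)%N ->
  mono_span (b - a + mono_deg s) (rho a b *m mono s).
Proof.
move=> + lab; have Ja : subi a by rewrite /sub_index (leq_trans lab) // -ltnS.
have [->|nbN] := eqVneq b N.
  by move=> Js; apply: mono_span_raise => //; apply: ms_mono.
have Jb : subi b by rewrite sub_index_neq.
elim: s => [_|p s IH /= /andP[Jp Js]].
  by rewrite /= wsing //; apply: ms_zero.
rewrite rho_comm_vec; apply: ms_add.
  apply: ms_scale; rewrite mono_deg_cons addnCA.
  by apply: mono_span_raise => //; apply: IH.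
have /negPf-> : a != N by rewrite -sub_index_neq.
rewrite scale0r scaler0 subr0; have [<-|_] := eqVneq b p; last first.
  by rewrite scale0r; apply: ms_zero.
rewrite scale1r mono_deg_cons addnA.
have -> : (b - a + (m + n - b) = m + n - a)%N.
  by rewrite addnC addnBA ?(ltnW lab) // subnK // ltnW.
by apply: mono_span_raise => //; apply: ms_mono.
Qed.

Lemma singular_mono : exists s, [/\ all subi s, mono s != 0 & is_singular (mono s)].
Proof.
have [K HK] := mono_bounded.
suff [s [Js s0 smax]] : exists s, [/\ all subi s, mono s != 0 &
    forall t, all subi t -> (mono_deg s < mono_deg t)%N -> mono t = 0].
  exists s; split=> // a b lab; have := mono_raise Js lab.
  have : (mono_deg s < b - a + mono_deg s)%N by rewrite -addn1 addnC leq_add2r subn_gt0.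
  move: (_ + _)%N (rho a b *m _) => z x ltz.
  elim=> {x} [//|t Jt tz|x y _ -> _ ->|c x _ ->]; rewrite ?addr0 ?scaler0 //.
  by apply: smax; rewrite ?tz.
(* As long as some nonzero monomial has larger degree, pass to it; degrees stay below K. *)
have aux j s : all subi s -> mono s != 0 -> (K - mono_deg s <= j)%N ->
    exists s, [/\ all subi s, mono s != 0 &
    forall t, all subi t -> (mono_deg s < mono_deg t)%N -> mono t = 0].
  elim: j s => [|j IH] s Js s0.
    rewrite leqn0 subn_eq0 => le; by move: s0; rewrite HK ?eqxx.
  move=> le; have [[t [Jt lt t0]]|nt] := Classical_Prop.classic
      (exists t, [/\ all subi t, (mono_deg s < mono_deg t)%N & mono t != 0]).
    by apply: (IH t) => //; move: le lt; lia.
  exists s; split=> // t Jt lt; apply/eqP/negPn/negP => t0.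
  by apply: nt; exists t.
exact: (aux (K - mono_deg [::])%N [::] isT w0 (leqnn _)).
Qed.

(** The odd operator E_rN moves, up to sign, through the other E_pN until it meets its own copy, and
    its square equals its own negative. *)
Lemma mono_repeat (r : idx) s : (r < m)%N -> all subi s -> r \in s ->
  rho r N *m mono s = 0.
Proof.
move=> lrm; have odd_r : e r (+) e N = true by rewrite par_max /par ltnNge lrm.
have nrN : r != N by rewrite -sub_index_neq /sub_index (leq_trans lrm) ?leq_addr.
elim: s => //= p s IH /andP[Jp Js].
have npN : (N == p) = false by apply/negbTE; rewrite eq_sym -sub_index_neq.
have E : rho r N *m (rho p N *m mono s) =
    sg (e p (+) e N) *: (rho p N *m (rho r N *m mono s)).
  by rewrite rho_comm_vec npN (negPf nrN) odd_r !scale0r scaler0 subrr addr0.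
rewrite inE => /orP[/eqP rp|rs]; last by rewrite E (IH Js rs) mulmx0 scaler0.
move: E; rewrite -rp odd_r /sgnb expr1 scaleN1r => /eqP.
by rewrite -addr_eq0 -mulr2n -scaler_nat scaler_eq0 pnatr_eq0 => /eqP.
Qed.

Lemma mono_count (r : idx) s : (r < m)%N -> all subi s -> mono s != 0 ->
  (count_mem r s <= 1)%N.
Proof.
move=> lrm; elim: s => //= p s IH /andP[Jp Js] ps0.
have s0 : mono s != 0 by apply: contraNneq ps0 => ->; rewrite mulmx0.
have [pr|_] := eqVneq p r; last exact: IH.
rewrite (count_memPn _) ?addn0 //; apply: contraNN ps0 => rs.
by rewrite pr mono_repeat.
Qed.

(** The singular monomial has the weight of v, and its r-th component exceeds that of w by the
    multiplicity of r, which is 0 or 1. *)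
Lemma branching v lt : v != 0 -> is_weight v lt -> is_singular v ->
  forall r : idx, (r < m)%N -> lt r = l r \/ lt r = l r + 1.
Proof.
move=> v0 vwt vs r lrm; have [s [Js s0 ss]] := singular_mono.
have := singular_weight_unique v0 vwt vs s0 (mono_wt Js) ss r.
rewrite /mono_weight; have /negPf-> : r != N.
  by rewrite -sub_index_neq /sub_index (leq_trans lrm) ?leq_addr.
rewrite subr0 => <-; have := mono_count lrm Js s0.
by case: (count_mem r s) => [|[|//]] _; [left; rewrite addr0 | right].
Qed.

End Monomials.
End Branching.

(** * Sums of signs over intervals of indices *)

Section SignSums.
Variable m : nat.

Definition sign_sum (k : nat) : C := \sum_(q < k) sgnb (par m q.+1).

Lemma sign_sumE k :
  sign_sum k = if (k <= m)%N then k%:R else m%:R - (k - m)%:R.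
Proof.
elim: k => [|k IH]; first by rewrite /sign_sum big_ord0.
rewrite /sign_sum big_ord_recr /= -/(sign_sum k) IH /par ltnS.
case: (ltngtP k m) => [lt|lt|->] /=; rewrite /sgnb ?expr0 ?expr1.
- by rewrite natr1.
- by rewrite subSn ?(ltnW lt) // -[in RHS]natr1; ring.
by rewrite subSnn.
Qed.

Lemma sign_sum_lt M (p : 'I_M) :
  \sum_(q : 'I_M | (q < p)%N) sgnb (par m q.+1) = sign_sum p.
Proof.
rewrite /sign_sum (big_ord_widen_cond M predT (fun q => sgnb (par m q.+1))) //.
exact: ltnW.
Qed.

Lemma sign_sum_gt M (p : 'I_M) :
  \sum_(q : 'I_M | (p < q)%N) sgnb (par m q.+1) = sign_sum M - sign_sum p.+1.
Proof.
rewrite [sign_sum M](bigID (fun q : 'I_M => (q < p.+1)%N)) /=.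
rewrite [sign_sum p.+1](big_ord_widen_cond M predT (fun q => sgnb (par m q.+1))) //=.
by rewrite addrC addrK; apply: eq_bigl => q; rewrite -ltnNge ltnS.
Qed.

End SignSums.

(** * Identification of the characteristic roots *)

Section Roots.
Variables m n : nat.
Local Notation idx := 'I_(m + n).+1.
Local Notation e p := (par m p.+1).
Local Notation N := (@ord_max (m + n)).
Local Notation alli := (@full_index m n).
Local Notation subi := (@sub_index m n).
Implicit Types (l : nat -> C) (p : idx).

Lemma par_le (p : idx) : e p = ~~ (p < m)%N.
Proof. by rewrite /par -leqNgt. Qed.

Lemma sign_sum_total : sign_sum m (m + n).+1 = m%:R - n%:R - 1.
Proof.
rewrite sign_sumE leqNgt ltnS leq_addr /= subSn ?leq_addr // addKn -natr1; ring.
Qed.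

Lemma root_beta l p : root_at alli id (fun p => l p.+1) p = beta m n l p.+1.
Proof.
rewrite /root_at /full_index /= sign_sum_gt sign_sum_total sign_sumE /beta par_le.
case: ltnP => /= h; rewrite /sgnb ?expr0 ?expr1; last by ring.
by ring.
Qed.

Lemma root_alpha l p : subi p ->
  root_at subi id (fun p => l p.+1) p = alpha m n l p.+1.
Proof.
move=> Jp; rewrite /root_at.
(* Leaving out the odd index N removes a summand -1; this is the difference between the shifts in
   alpha and beta. *)
have -> : \sum_(q : idx | subi q && (p < q)%N) sgnb (e q) =
    \sum_(q : idx | (p < q)%N) sgnb (e q) + 1.
  rewrite [in RHS](bigD1 N) /=; last exact: Jp.
  rewrite par_max /sgnb expr1 addrAC addNr add0r.
  by apply: eq_bigl => q; rewrite sub_index_neq andbC.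
rewrite sign_sum_gt sign_sum_total sign_sumE /alpha par_le.
by case: ltnP => /= h; rewrite /sgnb ?expr0 ?expr1; ring.
Qed.

Lemma rev_ord_lt M (p q : 'I_M) : (rev_ord p < rev_ord q)%N = (q < p)%N.
Proof. by rewrite /=; have := ltn_ord p; have := ltn_ord q; lia. Qed.

Lemma root_betabar l p :
  root_at alli (@rev_ord _) (fun p => - l p.+1) p = betabar m n l p.+1.
Proof.
rewrite /root_at /full_index; under eq_bigl do rewrite rev_ord_lt /=.
rewrite sign_sum_lt sign_sumE /betabar par_le.
case: (ltngtP p m) => /= h; rewrite /sgnb ?expr0 ?expr1.
- by rewrite -[p.+1%:R]natr1; ring.
- by rewrite subSn ?(ltnW h) // -[(p - m).+1%:R]natr1; ring.
by rewrite h subSnn; ring.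
Qed.

(** In the reversed order the positions after p are the q < p, all of them in the gl(m|n) block, so
    the formula is that of [betabar]. *)
Lemma root_alphabar l p : subi p ->
  root_at subi (@rev_ord _) (fun p => - l p.+1) p = alphabar m n l p.+1.
Proof.
move=> Jp; rewrite -[RHS]/(betabar m n l p.+1) -root_betabar /root_at.
congr (_ + _); apply: eq_bigl => q; rewrite rev_ord_lt /= andb_idl // => lqp.
exact: (ltn_trans lqp Jp).
Qed.

End Roots.

(** * The dual representation *)

Section Dual.
Variables (m n d : nat).
Local Notation idx := 'I_(m + n).+1.
Local Notation op := 'M[C]_d.+1.
Variables (rho : idx -> idx -> op) (P : op).
Local Notation e p := (par m p.+1).

(** The sign is the one for which the matrix B of this representation is [opBbar]. *)
Definition dual_rep (p q : idx) : op :=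
  - (sgnb (e p (+) (e p && e q)) *: rho q p).

Lemma dual_super_rep : is_super_rep rho -> is_super_rep dual_rep.
Proof.
move=> rhoP p q r s /=; rewrite /dual_rep !mulmxE.
have E a b (A B : op) : - (a *: A) * - (b *: B) = (a * b) *: (A * B).
  by rewrite mulrNN -scalerAl -scalerAr scalerA.
rewrite 2!E (rho_comm rhoP q p s r).
move: (rho s r * rho q p) => z.
by have [->|_] := eqVneq q r; have [->|_] := eqVneq p s; mx_ring.
Qed.

Lemma dual_grading : is_grading rho P -> is_grading dual_rep P.
Proof.
move=> [PP PG]; split=> // p q; have := PG q p; rewrite /dual_rep !mulmxE.
rewrite mulrN mulNr -scalerAl -scalerAr => ->.
by move: (P * rho q p) => z; mx_ring.
Qed.

Lemma opBbar_dual : opBbar rho = trunc dual_rep (@full_index m n).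
Proof.
apply/matrixP => p q; rewrite !mxE /=.
by rewrite /dual_rep; move: (rho q p) => z; mx_ring.
Qed.

Lemma opB_trunc : opB rho = trunc rho (@full_index m n).
Proof. by apply/matrixP => p q; rewrite !mxE. Qed.

Lemma dual_rep_inv p q : rho q p = - (sgnb (e p (+) (e p && e q)) *: dual_rep p q).
Proof. by rewrite /dual_rep scalerN sgK opprK. Qed.

Lemma dual_comm (Z : op) :
  (forall p q, Z * dual_rep p q = dual_rep p q * Z) ->
  forall p q, Z * rho p q = rho p q * Z.
Proof.
by move=> cZ p q; rewrite (dual_rep_inv q p) mulrN mulNr -scalerAl -scalerAr cZ.
Qed.

End Dual.

(** * Corner entries of the projections *)

Section Projections.
Variables (m n d : nat).
Local Notation idx := 'I_(m + n).+1.
Local Notation op := 'M[C]_d.+1.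
Local Notation vec := 'cV[C]_d.+1.
Local Notation opmx := 'M[op]_((m + n).+1).
Hypothesis m_gt0 : (0 < m)%N.
Local Notation e p := (par m p.+1).
Local Notation N := (@ord_max (m + n)).
Local Notation alli := (@full_index m n).
Local Notation subi := (@sub_index m n).

Lemma Qproj_corner (X : opmx) (b : nat -> C) (r : idx) :
  Qproj X b r N N =
  (\prod_(k : idx | k != r) (b r.+1 - b k.+1)^-1) *:
    ev X (node_poly (fun p : idx => b p.+1) r) N N.
Proof.
rewrite -evZ -mul_polyC mulrC (rmorph_prod polyC) -big_split rmorph_prod /=.
rewrite /Qproj; congr (fun_of_matrix _ N N); apply: eq_bigr => k _.
by rewrite rmorphM /= ev_shift_X evC.
Qed.

Section Corner.
Variables (rho : idx -> idx -> op) (P : op).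
Hypothesis rhoP : is_super_rep rho.
Hypothesis gradP : is_grading rho P.
Local Notation Q b r := (Qproj (trunc rho alli) b r N N).

Lemma Qproj_comm b (r p q : idx) : subi p -> subi q ->
  rho p q * Q b r = Q b r * rho p q.
Proof.
rewrite !sub_index_neq Qproj_corner => Jp Jq; rewrite -scalerAr -scalerAl.
congr (_ *: _); exact: corner_comm.
Qed.

Lemma Qproj_grading b (r : idx) : Q b r * P = P * Q b r.
Proof.
by rewrite Qproj_corner -scalerAr -scalerAl (ev_diag_grading m_gt0 gradP).
Qed.

Lemma schur_submodule (W : vec -> Prop) (w : vec) (Z : op) (k : C) :
  irreducible_glmn_submodule rho P W -> W w -> w != 0 ->
  (forall p q, subi p -> subi q -> rho p q * Z = Z * rho p q) ->
  Z * P = P * Z -> Z *m w = k *: w -> forall u, W u -> Z *m u = k *: u.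
Proof.
move=> [[W0 [WD WZ]] [WP [Wrho irrW]]] Ww w0 Zrho ZP Zw u Wu.
have [] := irrW (fun u => W u /\ Z *m u = k *: u).
- split; first by rewrite mulmx0 scaler0.
  split=> [x y [Wx Zx] [Wy Zy]|c x [Wx Zx]].
    by split; [exact: WD | rewrite mulmxDr Zx Zy scalerDr].
  by split; [exact: WZ | rewrite -scalemxAr Zx !scalerA mulrC].
- move=> x [Wx Zx]; split; first exact: WP.
  by rewrite -op_mulE ZP op_mulE Zx scalemxAr.
- move=> p q x pq [Wx Zx]; split; first exact: Wrho.
  have /andP[Jp Jq] := pq.
  by rewrite -op_mulE -Zrho // op_mulE Zx scalemxAr.
- by move=> x [].
- by move=> /(_ w (conj Ww Zw)) w00; rewrite w00 eqxx in w0.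
by move=> /(_ u Wu) [].
Qed.

Section Value.
Variables (o : idx -> idx) (v w : vec) (lt l : idx -> C).
Hypothesis oK : involutive o.
Hypothesis vdiag : forall p, rho p p *m v = lt p *: v.
Hypothesis vup : forall p q, (o p < o q)%N -> rho p q *m v = 0.
Hypothesis schur : forall (Z : op) (k : C),
  (forall p q, Z * rho p q = rho p q * Z) -> Z * P = P * Z ->
  Z *m v = k *: v -> forall u : vec, Z *m u = k *: u.
Hypothesis wdiag : forall p, subi p -> rho p p *m w = l p *: w.
Hypothesis wup : forall p q, subi p -> subi q -> (o p < o q)%N ->
  rho p q *m w = 0.
Variables (a b : nat -> C) (I : nat -> bool).
Hypothesis bE : forall p, root_at alli o lt p = b p.+1.
Hypothesis aE : forall p, subi p -> root_at subi o l p = a p.+1.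
Hypothesis binj : distinct_on b (m + n).+1.
Hypothesis IP : forall p : idx, subi p ->
  if e p then I p.+1 = true
  else if I p.+1 then a p.+1 = b p.+1 else a p.+1 = b p.+1 + 1.
Hypothesis I_sub : forall p : idx, I p.+1 -> subi p.

Let zeta (p : idx) : C := if I p.+1 then a p.+1 + sgnb (e p) else b p.+1.

Lemma ord_distinct : injective (fun p : idx => b p.+1).
Proof. by move=> p q E; apply/val_inj; have [] := @binj p.+1 q.+1 (ltn_ord p) (ltn_ord q) E. Qed.

Lemma Qproj_value (s : idx) : Q b s *m w =
  (\prod_(k : idx | k != s) (b s.+1 - b k.+1)^-1 *
   \prod_(r | subi r) (b s.+1 - zeta r)) *: w.
Proof.
have inj : injective (root_at alli o lt).
  by move=> p q; rewrite !bE; apply: ord_distinct.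
have zP p : subi p -> if e p then zeta p = root_at subi o l p - 1
  else (root_at subi o l p = root_at alli o lt p /\ zeta p = root_at subi o l p + 1)
    \/ (root_at subi o l p = root_at alli o lt p + 1 /\ zeta p = root_at alli o lt p).
  move=> Jp; have := IP Jp; rewrite /zeta aE // bE.
  case: (e p) => [->|]; first by rewrite /sgnb expr1.
  by case: (I p.+1) => E; [left | right]; rewrite // /sgnb expr0.
have := corner_value m_gt0 rhoP gradP oK vdiag vup schur wdiag wup inj zP s.
rewrite Qproj_corner -scalemxAl bE => h.
rewrite (_ : node_poly _ s = node_poly (root_at alli o lt) s).
  by rewrite h scalerA.
by apply: eq_bigr => k _; rewrite bE.
Qed.

(** The numerator contains the factor b_s - zeta_s = 0. *)
Lemma Qproj_zero (s : idx) : subi s -> ~~ I s.+1 -> Q b s *m w = 0.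
Proof.
move=> Js nI; rewrite Qproj_value [X in _ * X](bigD1 s) //= /zeta (negPf nI).
by rewrite subrr mul0r mulr0 scale0r.
Qed.

(** For r in the gl(m|n) block but outside I, zeta_r = b_r, so the numerator factor of r cancels its
    denominator. The index s is never among these r. *)
Lemma Qproj_nonzero (s : idx) : I s.+1 || (s.+1 == (m + n).+1) -> Q b s *m w =
  ((\prod_(1 <= k < (m + n).+2 | (I k || (k == (m + n).+1)) && (k != s.+1))
      (b s.+1 - b k)^-1) *
  \prod_(1 <= r < (m + n).+2 | I r) (b s.+1 - a r - sgnb (par m r))) *: w.
Proof.
move=> Is; rewrite Qproj_value; congr (_ *: _).
rewrite !big_add1 /= !big_mkord.
pose It (k : idx) := I k.+1 || (k.+1 == (m + n).+1).
have ItE k : It k = I k.+1 || ~~ subi k.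
  by rewrite sub_index_neq negbK /It -val_eqE eqSS.
rewrite (bigID It) /= [X in _ * X](bigID (fun r : idx => I r.+1)) /=.
set X1 := \prod_(k | (k != s) && It k) _; set X2 := \prod_(k | _) _.
set Y1 := \prod_(r | subi r && I r.+1) _; set Y2 := \prod_(r | _) _.
have XY : X2 * Y2 = 1.
  rewrite /X2 (eq_bigl (fun r : idx => subi r && ~~ I r.+1)) => [|r].
    rewrite -big_split big1 //= => r /andP[Jr nI]; rewrite /zeta (negPf nI) mulVf //.
    rewrite subr_eq0; apply/eqP => /ord_distinct E.
    by move: Is; rewrite E -/(It r) ItE Jr (negPf nI).
  rewrite [RHS](_ : _ = ~~ It r); last by rewrite ItE negb_or negbK andbC.
  by have [->|] := eqVneq r s; rewrite ?(Is : It s).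
have -> : X1 * X2 * (Y1 * Y2) = X1 * Y1 by rewrite mulrACA XY mulr1.
congr (_ * _).
  by apply: eq_bigl => k; rewrite andbC.
apply: eq_big => [r|r /andP[_ Ir]]; first by rewrite andb_idl // => /I_sub.
by rewrite /zeta Ir opprD addrA.
Qed.



End Value.
End Corner.
End Projections.

(** * The missing weight component at the index N *)

Section Weights.
Variables (m n d : nat).
Local Notation idx := 'I_(m + n).+1.
Local Notation op := 'M[C]_d.+1.
Local Notation vec := 'cV[C]_d.+1.
Variables (rho : idx -> idx -> op) (P : op).
Hypothesis rhoP : is_super_rep rho.
Hypothesis gradP : is_grading rho P.
Hypothesis irrV : irreducible_rep rho P.
Local Notation N := (@ord_max (m + n)).
Local Notation subi := (@sub_index m n).

Lemma diag_sum_central (p q : idx) :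
  (\sum_r rho r r) * rho p q = rho p q * (\sum_r rho r r).
Proof.
apply/esym/eqP; rewrite -subr_eq0 mulr_sumr mulr_suml -sumrB; apply/eqP.
have E r : rho p q * rho r r - rho r r * rho p q =
    (r == q)%:R *: rho p q - (r == p)%:R *: rho p q.
  rewrite (rho_comm rhoP r r p q) addbb; move: (rho p q * rho r r) => z.
  by have [->|_] := eqVneq r p; have [->|_] := eqVneq _ q; mx_ring.
under eq_bigr do rewrite E.
rewrite sumrB -!scaler_suml.
have S t : \sum_(r : idx) (r == t)%:R = 1 :> C.
  by rewrite (bigD1 t) //= eqxx big1 ?addr0 // => i /negPf->.
by rewrite !S subrr.
Qed.

Lemma diag_sum_grading : (\sum_r rho r r) * P = P * (\sum_r rho r r).
Proof.
rewrite mulr_sumr mulr_suml; apply: eq_bigr => r _.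
have [_ PG] := gradP; have := PG r r.
by rewrite mulmxE addbb /sgnb expr0 scale1r.
Qed.

(* The weight of E_NN is forced by the central element sum_p E_pp. *)
Lemma full_weight (v w : vec) (lt : idx -> C) (l : nat -> C) : v != 0 ->
  is_weight rho v lt -> (forall p, subi p -> rho p p *m w = l p.+1 *: w) ->
  exists2 l' : idx -> C, is_weight rho w l' & forall p, subi p -> l' p = l p.+1.
Proof.
move=> v0 vwt wwt; pose tot := \sum_p lt p.
have Zw : (\sum_r rho r r) *m w = tot *: w.
  apply: (schur_irreducible irrV v0 diag_sum_central diag_sum_grading).
  by rewrite mulmx_suml scaler_suml; apply: eq_bigr => r _; apply: vwt.
exists (fun p => if subi p then l p.+1 else tot - \sum_(r : idx | subi r) l r.+1).
  move=> p; case: ifP => [/wwt //|/negbT]; rewrite sub_index_neq negbK => /eqP->.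
  have S : \sum_(i | i != N) rho i i *m w = (\sum_(r : idx | subi r) l r.+1) *: w.
    rewrite scaler_suml (eq_bigl subi) => [|r]; last by rewrite sub_index_neq.
    by apply: eq_bigr => r /wwt.
  move: Zw; rewrite mulmx_suml (bigD1 N) //= S => E.
  by rewrite scalerBl -E addrK.
by move=> p ->.
Qed.

End Weights.

(** * Eigenvalues on the submodule *)

Section Main.
Variables (m n d : nat).
Local Notation idx := 'I_(m + n).+1.
Local Notation op := 'M[C]_d.+1.
Local Notation vec := 'cV[C]_d.+1.
Hypothesis m_gt0 : (1 <= m)%N.
Variables (rho : idx -> idx -> op) (P : op) (Lt L : nat -> C) (W : vec -> Prop).
Hypothesis rhoP : is_super_rep rho.
Hypothesis gradP : is_grading rho P.
Hypothesis irrV : irreducible_rep rho P.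
Local Notation e p := (par m p.+1).
Local Notation N := (@ord_max (m + n)).
Local Notation alli := (@full_index m n).
Local Notation subi := (@sub_index m n).
Variables (v w : vec).
Hypothesis v0 : v != 0.
Hypothesis vdiag : forall p : idx, rho p p *m v = Lt p.+1 *: v.
Hypothesis vup : forall p q : idx, (p < q)%N -> rho p q *m v = 0.
Hypothesis irrW : irreducible_glmn_submodule rho P W.
Hypothesis Ww : W w.
Hypothesis w0 : w != 0.
Hypothesis wdiag : forall p : idx, (p < m + n)%N -> rho p p *m w = L p.+1 *: w.
Hypothesis wup : forall p q : idx, (p < q)%N -> (q < m + n)%N -> rho p q *m w = 0.
Hypothesis beta_inj : distinct_on (beta m n Lt) (m + n).+1.
Hypothesis betabar_inj : distinct_on (betabar m n Lt) (m + n).+1.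

Lemma highest_weight_step (r : idx) : (r < m)%N ->
  Lt r.+1 = L r.+1 \/ Lt r.+1 = L r.+1 + 1.
Proof.
move=> lrm; have Jr : subi r by rewrite /sub_index (leq_trans lrm) ?leq_addr.
have [l wl lE] := full_weight rhoP gradP irrV v0 vdiag wdiag.
rewrite -(lE r Jr); apply: (branching rhoP gradP irrV wl _ w0 v0 vdiag vup lrm).
by move=> p q _ Jq lpq; apply: wup.
Qed.

(** For even i, alpha_i = beta_i means tilde Lambda_i = Lambda_i + 1, and alpha_i = beta_i + 1 means
    tilde Lambda_i = Lambda_i. *)
Lemma Iset_cases (p : idx) : subi p -> if e p then Iset m n L Lt p.+1 = true
  else if Iset m n L Lt p.+1 then alpha m n L p.+1 = beta m n Lt p.+1
  else alpha m n L p.+1 = beta m n Lt p.+1 + 1.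
Proof.
move=> Jp; rewrite /Iset /I0 /I1 par_le.
case: (ltnP p m) => /= h; last first.
  have h1 : (m < p.+1 <= m + n)%N by rewrite ltnS h.
  by rewrite h1 ?orbT.
rewrite ltnS leqNgt h /= orbF; case: eqP => // ne.
have [E|E] := highest_weight_step h; move: ne; rewrite /alpha /beta h E; first by move=> _; ring.
by case; ring.
Qed.

(** The barred roots exchange the two branching cases: for even i they coincide exactly when alpha_i
    = beta_i + 1. *)
Lemma Iset'_cases (p : idx) : subi p -> if e p then Iset' m n L Lt p.+1 = true
  else if Iset' m n L Lt p.+1 then alphabar m n L p.+1 = betabar m n Lt p.+1
  else alphabar m n L p.+1 = betabar m n Lt p.+1 + 1.
Proof.
move=> Jp; rewrite /Iset' /I0bar /I1 par_le.
case: (ltnP p m) => /= h; last first.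
  have h1 : (m < p.+1 <= m + n)%N by rewrite ltnS h.
  by rewrite h1 ?orbT.
rewrite ltnS leqNgt h /= orbF /alpha /beta /alphabar /betabar h.
have [E|E] := highest_weight_step h; case: eqP => ne; rewrite E //.
- by case: ne; rewrite E; ring.
- have : (1 : C) = 0; last by move/eqP; rewrite oner_eq0.
  move: ne; rewrite E => /eqP; rewrite eq_sym -subr_eq0 => /eqP <-; ring.
ring.
Qed.

Lemma glmn_index (i : idx) : (i < m)%N -> subi i.
Proof. by move=> h; rewrite /sub_index (leq_trans h) ?leq_addr. Qed.

Lemma Iset_sub (p : idx) : Iset m n L Lt p.+1 -> subi p.
Proof. by case/orP=> [/andP[/andP[_ /glmn_index]]|/andP[_]]. Qed.

Lemma Iset'_sub (p : idx) : Iset' m n L Lt p.+1 -> subi p.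
Proof. by case/orP=> [/andP[/andP[_ /glmn_index]]|/andP[_]]. Qed.

Lemma schurV (Z : op) (k : C) : (forall p q, Z * rho p q = rho p q * Z) ->
  Z * P = P * Z -> Z *m v = k *: v -> forall u : vec, Z *m u = k *: u.
Proof. exact: schur_irreducible. Qed.

(** The value is computed on w and spread over W by [schur_submodule]. *)
Lemma c_op_value (s : idx) u : W u ->
  (Itil m n L Lt s.+1 -> c_op rho Lt s *m u = c_val m n L Lt s.+1 *: u) /\
  (I0bar m n L Lt s.+1 -> c_op rho Lt s *m u = 0).
Proof.
move=> Wu; rewrite /c_op opB_trunc.
have wd p : subi p -> rho p p *m w = L p.+1 *: w by apply: wdiag.
have wu p q : subi p -> subi q -> (p < q)%N -> rho p q *m w = 0.
  by move=> _ Jq lpq; apply: wup.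
have bE := @root_beta m n Lt; have aE := @root_alpha m n L.
split=> Is.
  apply: (schur_submodule irrW Ww w0) => //.
  - by move=> p q; apply: Qproj_comm.
  - exact: (Qproj_grading m_gt0 gradP).
  exact: (Qproj_nonzero m_gt0 rhoP gradP (fun _ => erefl) vdiag vup schurV wd wu
    bE aE beta_inj Iset_cases Iset_sub Is).
rewrite -(scale0r u); apply: (schur_submodule irrW Ww w0) => //.
- by move=> p q; apply: Qproj_comm.
- exact: (Qproj_grading m_gt0 gradP).
rewrite scale0r; have [/andP[_ lsm] /eqP E] := andP Is.
apply: (Qproj_zero m_gt0 rhoP gradP (fun _ => erefl) vdiag vup schurV wd wu
    bE aE beta_inj Iset_cases (glmn_index lsm)).
(* An index of bar I_0 is not in I, since beta_i + 1 = beta_i would give 1 = 0. *)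
rewrite /Iset /I0 /I1 lsm E /= ltnNge lsm /= orbF -subr_eq0 addrC addKr.
exact: oner_neq0.
Qed.

Lemma cbar_op_value (s : idx) u : W u ->
  (Itil' m n L Lt s.+1 -> cbar_op rho Lt s *m u = cbar_val m n L Lt s.+1 *: u) /\
  (I0 m n L Lt s.+1 -> cbar_op rho Lt s *m u = 0).
Proof.
move=> Wu; rewrite /cbar_op opBbar_dual.
have dP := dual_super_rep rhoP; have dG := dual_grading gradP.
have dd (x : vec) p c : rho p p *m x = c *: x -> dual_rep rho p p *m x = (- c) *: x.
  move=> xp; rewrite /dual_rep andbb addbb /sgnb expr0 scale1r mulNmx xp.
  by rewrite scaleNr.
have du (x : vec) p q : rho q p *m x = 0 -> dual_rep rho p q *m x = 0.
  by move=> xp; rewrite /dual_rep mulNmx -scalemxAl xp scaler0 oppr0.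
(* For the dual representation v and w are extremal in the reversed order, with negated weights. *)
have vd p : dual_rep rho p p *m v = (- Lt p.+1) *: v by apply: dd.
have vu (p q : idx) : (rev_ord p < rev_ord q)%N -> dual_rep rho p q *m v = 0.
  by rewrite rev_ord_lt => lqp; apply: du; apply: vup.
have wd p : subi p -> dual_rep rho p p *m w = (- L p.+1) *: w.
  by move=> Jp; apply: dd; apply: wdiag.
have wu (p q : idx) : subi p -> subi q -> (rev_ord p < rev_ord q)%N ->
    dual_rep rho p q *m w = 0.
  by move=> Jp _; rewrite rev_ord_lt => lqp; apply: du; apply: wup.
have sV (Z : op) (k : C) : (forall p q, Z * dual_rep rho p q = dual_rep rho p q * Z) ->
  Z * P = P * Z -> Z *m v = k *: v -> forall u : vec, Z *m u = k *: u.
  by move=> /dual_comm; apply: schurV.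
have bE := @root_betabar m n Lt; have aE := @root_alphabar m n L.
have Qc r p q : subi p -> subi q ->
    rho p q * Qproj (trunc (dual_rep rho) alli) (betabar m n Lt) r N N =
    Qproj (trunc (dual_rep rho) alli) (betabar m n Lt) r N N * rho p q.
  move=> Jp Jq; rewrite (dual_rep_inv rho q p) mulrN mulNr -scalerAl -scalerAr.
  by rewrite Qproj_comm.
split=> Is.
  apply: (schur_submodule irrW Ww w0) => //; first exact: Qc.
    exact: (Qproj_grading m_gt0 dG).
  exact: (Qproj_nonzero m_gt0 dP dG (@rev_ordK _) vd vu sV wd wu
    bE aE betabar_inj Iset'_cases Iset'_sub Is).
rewrite -(scale0r u); apply: (schur_submodule irrW Ww w0) => //; first exact: Qc.
  exact: (Qproj_grading m_gt0 dG).
rewrite scale0r; have [/andP[_ lsm] /eqP E] := andP Is.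
apply: (Qproj_zero m_gt0 dP dG (@rev_ordK _) vd vu sV wd wu
    bE aE betabar_inj Iset'_cases (glmn_index lsm)).
rewrite /Iset' /I0bar /I1 lsm E /= ltnNge lsm /= orbF eq_sym -subr_eq0 addrC addKr.
exact: oner_neq0.
Qed.

Lemma corner_ops_comm (r p q : idx) : subi p -> subi q ->
  rho p q *m c_op rho Lt r = c_op rho Lt r *m rho p q /\
  rho p q *m cbar_op rho Lt r = cbar_op rho Lt r *m rho p q.
Proof.
move=> Jp Jq; rewrite /c_op /cbar_op opB_trunc opBbar_dual !mulmxE; split.
  exact: Qproj_comm.
rewrite (dual_rep_inv rho q p) mulrN mulNr -scalerAl -scalerAr.
by rewrite (Qproj_comm (dual_super_rep rhoP)).
Qed.

End Main.

Theorem theorem3 (m n d : nat) (hm : (1 <= m)%N) (hn : (1 <= n)%N)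
  (rho : 'I_(m + n).+1 -> 'I_(m + n).+1 -> 'M[C]_d) (P : 'M[C]_d)
  (Lt L : nat -> C) (W : 'cV[C]_d -> Prop) :
  is_super_rep rho ->
  is_grading rho P ->
  irreducible_rep rho P ->
  has_highest_weight rho Lt ->
  irreducible_glmn_submodule rho P W ->
  glmn_highest_weight rho W L ->
  distinct_on (beta m n Lt) (m + n).+1 ->
  distinct_on (betabar m n Lt) (m + n).+1 ->
  distinct_on (alpha m n L) (m + n) ->
  distinct_on (alphabar m n L) (m + n) ->
  (* c_r and cbar_r commute with gl(m|n) *)
  (forall (r p q : 'I_(m + n).+1), (p < m + n)%N -> (q < m + n)%N ->
      rho p q *m c_op rho Lt r = c_op rho Lt r *m rho p q /\
      rho p q *m cbar_op rho Lt r = cbar_op rho Lt r *m rho p q) /\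
  (* eigenvalues of c on V(Lambda) *)
  (forall s : 'I_(m + n).+1, Itil m n L Lt s.+1 ->
      forall w, W w -> c_op rho Lt s *m w = c_val m n L Lt s.+1 *: w) /\
  (forall i : 'I_(m + n).+1, I0bar m n L Lt i.+1 ->
      forall w, W w -> c_op rho Lt i *m w = 0) /\
  (* eigenvalues of cbar on V(Lambda) *)
  (forall s : 'I_(m + n).+1, Itil' m n L Lt s.+1 ->
      forall w, W w -> cbar_op rho Lt s *m w = cbar_val m n L Lt s.+1 *: w) /\
  (forall i : 'I_(m + n).+1, I0 m n L Lt i.+1 ->
      forall w, W w -> cbar_op rho Lt i *m w = 0).
Proof.
(* The lemmas concern dimension [d.+1]; dimension zero is excluded by the nonzero highest weight
   vector. *)
case: d rho P W => [|d] rho P W rhoP gradP irrV [v [v0 [vdiag vup]]] irrW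
  [w [Ww [w0 [wdiag wup]]]] beta_inj betabar_inj _ _.
  by rewrite (flatmx0 v) eqxx in v0.
have cval := c_op_value hm rhoP gradP irrV v0 vdiag vup irrW Ww w0 wdiag wup beta_inj.
have cbarval :=
  cbar_op_value hm rhoP gradP irrV v0 vdiag vup irrW Ww w0 wdiag wup betabar_inj.
split; first by move=> r p q Jp Jq; apply: corner_ops_comm.
split; first by move=> s Is u Wu; apply: (cval s u Wu).1.
split; first by move=> s Is u Wu; apply: (cval s u Wu).2.
split; first by move=> s Is u Wu; apply: (cbarval s u Wu).1.
by move=> s Is u Wu; apply: (cbarval s u Wu).2.
Qed.
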